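(* Let $n,m,m'$ be non-negative integers with $n\ge 1$, let $\alpha=(\alpha_1,\dots,\alpha_m)$ and $\beta=(\beta_1,\dots,\beta_{m'})$ be vectors of non-negative integers, and let $\lambda$ be a partition of $n$. The multiplicity of the irreducible $S_n$-module indexed by $\lambda$ in the homogeneous component of $\mathbb{C}[X_{n\times m};\Theta_{n\times m'}]$ of degree $\alpha$ in the commuting variables and degree $\beta$ in the Grassmannian variables is equal to the number of multiset tableaux of shape $\lambda$ and content $\{\!\{1^{\alpha_1},2^{\alpha_2},\dots,m^{\alpha_m},\bar1^{\beta_1},\dots,\overline{m'}^{\beta_{m'}}\}\!\}$.
   Context: $\mathbb{C}[X_{n\times m};\Theta_{n\times m'}]$ is the associative $\mathbb{C}$-algebra generated by variables $x_{rk}$ ($1\le r\le n$, $1\le k\le m$) and $\theta_{ri}$ ($1\le r\le n$, $1\le i\le m'$) subject to: the $x_{rk}$ commute with each other and with all $\theta_{si}$; $\theta_{ri}\theta_{sj}=-\theta_{sj}\theta_{ri}$ for $(r,i)\neq(s,j)$; and $\theta_{ri}^2=0$. The symmetric group $S_n$ acts by algebra automorphisms via $\sigma(x_{rk})=x_{\sigma(r)k}$, $\sigma(\theta_{ri})=\theta_{\sigma(r)i}$. A monomial has degree $\alpha=(\alpha_1,\dots,\alpha_m)$ in the commuting variables and $\beta=(\beta_1,\dots,\beta_{m'})$ in the Grassmannian variables if its total degree in $x_{1k},\dots,x_{nk}$ is $\alpha_k$ for each $k$ and its total degree in $\theta_{1i},\dots,\theta_{ni}$ is $\beta_i$ for each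 $i$; the span of such monomials is an $S_n$-submodule. Irreducible $S_n$-modules are indexed by partitions of $n$ in the standard way. Alphabet: $[m]\cup[\overline{m'}]=\{1,\dots,m\}\cup\{\bar1,\dots,\overline{m'}\}$, totally ordered by $1<2<\dots<m<\bar1<\dots<\overline{m'}$. Entries $\bar j$ are called barred. Finite multisets over this alphabet are totally ordered as follows: write each multiset as its weakly increasing word and compare words lexicographically (a proper prefix being smaller); in particular the empty multiset is the smallest. For a partition $\lambda=(\lambda_1\ge\lambda_2\ge\dots)$, its cells are the pairs $(i,j)$ with $1\le i\le\ell(\lambda)$, $1\le j\le\lambda_i$ ($i$ = row, $j$ = column). A multiset tableau of shape $\lambda$ is a map $T$ from the cells of $\lambda$ to finite (possibly empty) multisets over $[m]\cup[\overline{m'}]$ such that: (1) no barred entry appears more than once in any $T(c)$; (2) $T(i,j)\le T(i+1,j)$ and $T(i,j)\le T(i,j+1)$ whenever both cells lie in $\lambda$; (3) if a multiset $S$ contains an even number (possibly zero) of barred entries, then any two distinct cells labelled $S$ lie in different columns; (4) if $S$ contains an odd number of barred entries, then any two distinct cells labelled $S$ lie in different rows. The content of $T$ is the multiset union of all $T(c)$. $\{\!\{1^{a_1},\dots\}\!\}$ denotes the multiset containing $1$ with multiplicity $a_1$, etc. *)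

(* Defs.v *)
From HB Require Import structures.
From mathcomp Require Import all_boot all_order all_algebra all_fingroup all_solvable all_field all_character.
Set Implicit Arguments. Unset Strict Implicit. Unset Printing Implicit Defensive.
Import GRing.Theory Num.Theory.
Local Open Scope ring_scope.

Section SignedPerm.
Variables (gT : finGroupType) (G : {group gT}) (X : finType)
  (act : X -> gT -> X) (c : gT -> X -> algC).
Hypotheses (act1 : forall x, act x 1%g = x)
  (actM : forall x g h, act x (g * h)%g = act (act x g) h)
  (c1 : forall x, c 1%g x = 1)
  (cM : forall g h x, c (g * h)%g x = c g x * c h (act x g)).

Definition spr_mx (g : gT) : 'M[algC]_#|X| :=
  \matrix_(i, j) (c g (enum_val i) * (act (enum_val i) g == enum_val j)%:R).

Lemma spr_mx_repr : mx_repr G spr_mx.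
Proof.
split=> [|g h _ _]; apply/matrixP=> i j; rewrite !mxE.
  by rewrite act1 c1 mul1r (inj_eq enum_val_inj).
rewrite (bigD1 (enum_rank (act (enum_val i) g))) //= big1 => [|k /negbTE nk].
  rewrite !mxE enum_rankK eqxx mulr1 addr0 cM actM mulrA.
  by [].
rewrite !mxE; case: eqP => [e|]; last by rewrite !mulr0 mul0r.
by rewrite e enum_valK eqxx in nk.
Qed.
End SignedPerm.
Definition flip n (s : 'S_n) (P : {set 'I_n}) : bool :=
  [exists x in P, exists y in P, (x < y)%N && (s y < s x)%N].

Definition setsgn n (s : 'S_n) (R : {set 'I_n}) : algC :=
  \prod_(P : {set 'I_n} | (P \subset R) && (#|P| == 2%N))
     (if flip s P then -1 else 1).

Lemma ex_set2 (T : finType) (x y : T) (P : pred T) :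
  [exists a in [set x; y], P a] = P x || P y.
Proof.
apply/existsP/orP=> [[a /andP[]]|[Px|Py]].
  by rewrite !inE => /orP[]/eqP->; [left|right].
  by exists x; rewrite !inE eqxx Px.
by exists y; rewrite !inE eqxx orbT Py.
Qed.

Lemma flip2 n (s : 'S_n) (x y : 'I_n) : x != y ->
  flip s [set x; y] = ((x < y)%N != (s x < s y)%N).
Proof.
move=> nxy; have nsxy : s x != s y by rewrite (inj_eq perm_inj).
rewrite /flip ex_set2 !ex_set2 !ltnn /=.
have nxy' : (x : nat) != y by [].
have nsxy' : (s x : nat) != s y by [].
case: (ltngtP x y) => [lxy|lyx|exy]; last by rewrite exy eqxx in nxy'.
  by rewrite /= orbF; case: (ltngtP (s x) (s y)) => //= e; rewrite e eqxx in nsxy'.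
by rewrite /= orbF; case: (ltngtP (s x) (s y)) => //= e; rewrite e eqxx in nsxy'.
Qed.

Lemma flipM n (s t : 'S_n) (P : {set 'I_n}) : #|P| == 2%N ->
  flip (s * t) P = flip s P (+) flip t (s @: P).
Proof.
case/cards2P=> x [y [nxy ->]].
rewrite imsetU1 imset_set1 !flip2 ?(inj_eq perm_inj) // !permM.
by case: (x < y)%N; case: (s x < s y)%N; case: (t (s x) < t (s y))%N.
Qed.

Lemma setsgnM n (s t : 'S_n) (R : {set 'I_n}) :
  setsgn (s * t) R = setsgn s R * setsgn t (s @: R).
Proof.
have sub : forall A B : {set 'I_n}, (s @: A \subset s @: B) = (A \subset B).
  move=> A B; apply/idP/idP; last exact: imsetS.
  move=> /(imsetS (s^-1)%g); rewrite -!imset_comp.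
  have e : forall C : {set 'I_n}, [set ((s^-1)%g \o s) x | x in C] = C.
    by move=> C; rewrite -[RHS]imset_id; apply: eq_imset => x /=; rewrite permK.
  by rewrite !e.
rewrite /setsgn [X in _ = _ * X](reindex_inj (imset_inj (@perm_inj _ s))) /=.
have cs : forall P : {set 'I_n}, #|s @: P| = #|P| by move=> P; apply: card_imset; exact: perm_inj.
under [X in _ = _ * X]eq_bigl => P do rewrite sub cs.
rewrite -big_split /=; apply: eq_bigr => P /andP[_ P2].
by rewrite flipM //; case: (flip s P); case: (flip t _); rewrite ?mulN1r ?mul1r ?opprK.
Qed.

Lemma setsgn1 n (R : {set 'I_n}) : setsgn 1 R = 1.
Proof.
apply: big1 => P _; suff -> : flip 1 P = false by [].
by apply/existsP=> -[x /andP[_ /existsP[y]]]; rewrite !perm1 => /andP[_ /andP[/ltnW]]; rewrite leqNgt => /negPf->.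
Qed.

Definition Sn (n : nat) : {group 'S_n} := [set: 'S_n]%G.

Section Component.
Variables (n m mp : nat) (alpha : 'I_m -> nat) (beta : 'I_mp -> nat).

(* A monomial: exponents e k r of x_{rk} (bounded by sum alpha, which is
   no restriction in degree alpha) and, for each Grassmannian column i,
   the set of rows r with theta_{ri} occurring.  The theta's of a
   monomial are multiplied in the fixed order: column by column, rows
   increasing within a column. *)
Definition monomial : finType := ({ffun 'I_m -> {ffun 'I_n -> 'I_(\sum_k alpha k).+1}}
                        * {ffun 'I_mp -> {set 'I_n}})%type.

Definition has_degree (x : monomial) : bool :=
  [forall k, \sum_r (x.1 k r : nat) == alpha k] &&
  [forall i, #|x.2 i| == beta i].

Definition deg_monomial : finType := {x : monomial | has_degree x}.

(* sigma sends x_{rk} to x_{sigma(r) k} and theta_{ri} to theta_{sigma(r) i} *)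
Definition mon_act (x : monomial) (s : 'S_n) : monomial :=
  ([ffun k => [ffun r => x.1 k ((s^-1)%g r)]], [ffun i => s @: x.2 i]).

Lemma mon_act_deg (x : monomial) s : has_degree x -> has_degree (mon_act x s).
Proof.
case/andP=> /forallP Ha /forallP Hb; apply/andP; split; apply/forallP=> k /=.
  rewrite -(eqP (Ha k)) (reindex_inj (@perm_inj _ s)) /=.
  by apply/eqP/eq_bigr=> r _; rewrite !ffunE permK.
by rewrite ffunE card_imset ?Hb //; exact: perm_inj.
Qed.

Definition dmon_act (x : deg_monomial) (s : 'S_n) : deg_monomial :=
  Sub (mon_act (val x) s) (mon_act_deg s (valP x)).

(* sign: sigma(theta-monomial of x) = mon_sign sigma x * theta-monomial of sigma.x *)
Definition mon_sign (s : 'S_n) (x : deg_monomial) : algC :=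
  \prod_i setsgn s ((val x).2 i).

Lemma dmon_act1 x : dmon_act x 1%g = x.
Proof.
apply: val_inj; case: x => -[e S] Hx /=; rewrite /mon_act /=; congr (_, _).
  by apply/ffunP=> k; apply/ffunP=> r; rewrite !ffunE invg1 perm1.
apply/ffunP=> i; rewrite ffunE -[RHS]imset_id; apply: eq_imset => r.
by rewrite perm1.
Qed.

Lemma dmon_actM x s t : dmon_act x (s * t)%g = dmon_act (dmon_act x s) t.
Proof.
apply: val_inj; case: x => -[e S] Hx /=; rewrite /mon_act /=; congr (_, _).
  by apply/ffunP=> k; apply/ffunP=> r; rewrite !ffunE invMg permM.
apply/ffunP=> i; rewrite !ffunE -imset_comp; apply: eq_imset => r.
by rewrite permM.
Qed.

Lemma mon_sign1 x : mon_sign 1%g x = 1.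
Proof. by apply: big1 => i _; exact: setsgn1. Qed.

Lemma mon_signM s t x :
  mon_sign (s * t)%g x = mon_sign s x * mon_sign t (dmon_act x s).
Proof.
rewrite /mon_sign -big_split /=; apply: eq_bigr => i _.
by rewrite setsgnM ffunE.
Qed.

Definition component_repr : mx_representation algC (Sn n) #|deg_monomial| :=
  MxRepresentation (spr_mx_repr (Sn n) dmon_act1 dmon_actM mon_sign1 mon_signM).

End Component.

Definition is_partition (n : nat) (lam : seq nat) : bool :=
  [&& sumn lam == n, sorted geq lam & 0 \notin lam].

Section Specht.
Variables (n : nat) (lam : seq nat).

(* the canonical tableau fills row i with sumn (take i lam), ..., 
   sumn (take i.+1 lam) - 1; rowof / colof give the (0-based) cell of x *)
Definition rowof (x : nat) : nat :=
  count (fun i => sumn (take i.+1 lam) <= x)%N (iota 0 (size lam)).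
Definition colof (x : nat) : nat := x - sumn (take (rowof x) lam).

Definition row_group : {set 'S_n} :=
  [set p : 'S_n | [forall x : 'I_n, rowof (p x) == rowof x]].
Definition col_group : {set 'S_n} :=
  [set q : 'S_n | [forall x : 'I_n, colof (q x) == colof x]].

(* Young symmetrizer sum_{p in R, q in C} sgn(q) p q, as a vector of
   the group algebra C[S_n] (coordinates indexed as in regular_repr) *)
Definition young_symmetrizer : 'rV[algC]_#|Sn n| :=
  \row_(i < #|Sn n|) \sum_(p in row_group) \sum_(q in col_group)
      ((p * q)%g == enum_val i)%:R * (-1) ^+ odd_perm q.

Definition specht_repr :=
  submod_repr (cyclic_mx_module (regular_repr algC (Sn n)) young_symmetrizer).

End Specht.

Fixpoint lexle (s t : seq nat) : bool :=
  match s, t with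
  | [::], _ => true
  | _ :: _, [::] => false
  | x :: s', y :: t' => (x < y)%N || ((x == y) && lexle s' t')
  end.

Section MultisetTableaux.
Variables (n m mp : nat) (alpha : 'I_m -> nat) (beta : 'I_mp -> nat)
          (lam : seq nat).

(* letters: inl k is the unbarred letter k, inr i is the barred letter i *)
Definition letter : finType := ('I_m + 'I_mp)%type.

(* a finite multiset over the alphabet, given by its multiplicities
   (bounded by the total content size, which is no restriction for the
   labels of a tableau of that content) *)
Definition mset : finType := {ffun letter -> 'I_(\sum_k alpha k + \sum_i beta i).+1}.

(* the weakly increasing word of a multiset, encoding the letter k as
   k and the barred letter i as m + i (so 1 < .. < m < 1bar < ..) *)
Definition mset_word (M : mset) : seq nat :=
  flatten ([seq nseq (M (inl k)) (k : nat) | k <- enum 'I_m] ++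
           [seq nseq (M (inr i)) (m + i)%N | i <- enum 'I_mp]).

Definition msle (M N : mset) : bool := lexle (mset_word M) (mset_word N).

Definition nbarred (M : mset) : nat := \sum_i (M (inr i) : nat).

Definition in_shape (p : 'I_n * 'I_n) : bool :=
  (p.1 < size lam)%N && (p.2 < nth 0 lam p.1)%N.
Definition cell : finType := {p : 'I_n * 'I_n | in_shape p}.
Definition crow (c : cell) : nat := (val c).1.
Definition ccol (c : cell) : nat := (val c).2.

Definition is_multiset_tableau (T : {ffun cell -> mset}) : bool :=
  [&& [forall c, forall i, (T c (inr i) <= 1)%N],
      [forall c, forall d,
         ((crow d == (crow c).+1) && (ccol d == ccol c)) ==> msle (T c) (T d)],
      [forall c, forall d,
         ((crow d == crow c) && (ccol d == (ccol c).+1)) ==> msle (T c) (T d)],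
      [forall c, forall d,
         [&& c != d, T c == T d & ~~ odd (nbarred (T c))] ==> (ccol c != ccol d)] &
      [forall c, forall d,
         [&& c != d, T c == T d & odd (nbarred (T c))] ==> (crow c != crow d)]].

Definition has_content (T : {ffun cell -> mset}) : bool :=
  [forall k, \sum_c (T c (inl k) : nat) == alpha k] &&
  [forall i, \sum_c (T c (inr i) : nat) == beta i].

Definition multiset_tableaux : {set {ffun cell -> mset}} :=
  [set T | is_multiset_tableau T && has_content T].

End MultisetTableaux.

(* Main.v *)
(** The Specht module is the right ideal generated by e = a b, with a the row
    symmetrizer and b the column antisymmetrizer.  Von Neumann's lemma makes e a
    nonzero multiple of an idempotent, so the multiplicity of the Specht module in
    a module V is the rank of e on V.  The degree component is a signed permutation
    module whose basis is the set of fillings of the cells of lam by multisets;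
    exchanging two cells with equal labels costs the sign (-1)^(number of barred
    entries).  The vectors T.a.b with T a multiset tableau span V.a.b: every other
    filling is straightened with Garnir relations.  They are independent: if T'
    occurs in T.a.b then some row rearrangement of T is a column rearrangement of
    T', and sorted columns make the row sums of T' lexicographically minimal among
    its column rearrangements. *)
Require Import Defs.
From HB Require Import structures.
From mathcomp Require Import all_boot all_order all_algebra all_fingroup all_solvable all_field all_character.
From mathcomp Require Import zify.
Set Implicit Arguments. Unset Strict Implicit. Unset Printing Implicit Defensive.
Import Order.TTheory GRing.Theory Num.Theory.
Local Open Scope ring_scope.

(** * Cells of the canonical tableau *)

(** [rowof] is defined by counting; peeling off the first part gives the recursion on which the next
    facts about cells go by induction. *)
Lemma rowof_cons a l x :
  rowof (a :: l) x = if (x < a)%N then 0%N else (rowof l (x - a)).+1.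
Proof.
rewrite /rowof /= take0 /= addn0 -[1%N]addn0 iotaDl count_map.
case: ltnP => ax /=; last first.
  by rewrite add1n; congr _.+1; apply: eq_count => i /=; rewrite leq_subRL // add1n.
apply/eqP; rewrite -leqn0 leqNgt -has_count; apply/hasPn => i _ /=.
by rewrite -ltnNge (leq_trans ax) // leq_addr.
Qed.

Lemma colof_cons a l x :
  colof (a :: l) x = if (x < a)%N then x else colof l (x - a).
Proof.
rewrite /colof rowof_cons; case: ltnP => ax /=; first by rewrite subn0.
by rewrite subnDA.
Qed.

Lemma rowof_colof_inj l x y :
  rowof l x = rowof l y -> colof l x = colof l y -> x = y.
Proof.
elim: l x y => [|a l IHl] x y; first by rewrite /colof /= !subn0.
rewrite !rowof_cons !colof_cons.
case: ltnP => ax; case: ltnP => ay // [er] ec.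
by rewrite -(subnK ax) -(subnK ay) (IHl _ _ er ec).
Qed.

Lemma colof_lt l x : (x < sumn l)%N -> (colof l x < nth 0 l (rowof l x))%N.
Proof.
elim: l x => [|a l IHl] x //=; rewrite rowof_cons colof_cons.
by case: (ltnP x a) => ax xs //=; apply: IHl; rewrite ltn_subLR.
Qed.

Lemma exists_cell l i j : (j < nth 0 l i)%N ->
  exists2 x, (x < sumn l)%N & rowof l x = i /\ colof l x = j.
Proof.
elim: l i => [|a l IHl] [|i] //= ji.
  by exists j; rewrite ?rowof_cons ?colof_cons ?ji // (leq_trans ji) // leq_addr.
have [x xs [xi xj]] := IHl _ ji; exists (a + x)%N; first by rewrite ltn_add2l.
by rewrite rowof_cons colof_cons ltnNge leq_addr /= addKn xi xj.
Qed.

Section Shape.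
Variables (n : nat) (lam : seq nat).
Hypothesis lamP : is_partition n lam.

Implicit Types r : 'I_n.
Notation row r := (rowof lam (nat_of_ord r)).
Notation col r := (colof lam (nat_of_ord r)).

Lemma cell_inj r r' : row r = row r' -> col r = col r' -> r = r'.
Proof. by move=> er ec; apply/val_inj/(rowof_colof_inj er ec). Qed.

Lemma col_lt r : (col r < nth 0 lam (row r))%N.
Proof. by apply: colof_lt; case/and3P: lamP => /eqP-> _ _. Qed.

Lemma cell_at i j : (j < nth 0 lam i)%N -> exists r, row r = i /\ col r = j.
Proof.
have /and3P[/eqP ls _ _] := lamP.
by case/exists_cell=> x; rewrite ls => xn [xi xj]; exists (Ordinal xn).
Qed.

Lemma part_le i j : (i <= j)%N -> (nth 0 lam j <= nth 0 lam i)%N.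
Proof.
move=> ij; have [js|sj] := ltnP j (size lam); last by rewrite nth_default.
have /and3P[_ ls _] := lamP.
apply: (sorted_leq_nth _ _ 0%N ls); rewrite ?inE ?(leq_ltn_trans ij) //.
  by move=> b a c; rewrite /geq /= => ba cb; apply: leq_trans cb ba.
by move=> a; apply: leqnn.
Qed.

(** The parts weakly decrease, so a column occupies consecutive rows starting from the top one. *)
Lemma cell_above r i : (i <= row r)%N -> exists r', row r' = i /\ col r' = col r.
Proof. by move=> ir; apply/cell_at/(leq_trans (col_lt r))/part_le. Qed.

(* [q] sorts each column of the filling [U]; distinct entries in a column force
   the [k]-th smallest one to be at least [k]. *)
Lemma column_sort (U : 'I_n -> nat) :
    (forall r r', col r = col r' -> U r = U r' -> r = r') ->
  exists2 q, q \in col_group n lam & forall r, (row (q r) <= U r)%N.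
Proof.
move=> Uinj.
pose B r := [set y : 'I_n | (col y == col r) && (U y < U r)%N].
have Ble r : (#|B r| <= U r)%N.
  have Uy (y : 'I_n) : y \in B r -> (U y < U r)%N by rewrite inE => /andP[].
  have [e|Upos] := posnP (U r).
    by rewrite e leqn0 cards_eq0; apply/eqP/setP => y; rewrite !inE e ltn0 andbF.
  (* [U] maps [B r] injectively into the numbers below [U r]; [.-1.+1] gives this bound the
     successor form that [inord] asks for. *)
  pose f (y : 'I_n) : 'I_(U r).-1.+1 := inord (U y).
  rewrite -[X in (_ <= X)%N](prednK Upos) -[X in (_ <= X)%N]card_ord.
  rewrite -(@card_in_imset _ _ f (mem (B r))); first exact: max_card.
  move=> y z yB zB /(congr1 val) /=; rewrite !inordK ?prednK ?Uy // => e.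
  move: yB zB; rewrite !inE => /andP[/eqP cy _] /andP[/eqP cz _].
  by apply: Uinj; rewrite ?cy.
have Bcell r : exists r', row r' = #|B r| /\ col r' = col r.
  (* [m] is the lowest cell in the column of [r]. That column has at most [row m + 1] cells and
     [B r] misses [r], so row [#|B r|] still meets the column. *)
  pose m := [arg max_(y > r | col y == col r) row y].
  have [cm mmax] : col m = col r /\ forall y : 'I_n, col y = col r -> (row y <= row m)%N.
    rewrite /m; case: arg_maxnP => // y /eqP cy ymax.
    by split=> // z /eqP /ymax.
  rewrite -cm; apply: cell_above; rewrite -ltnS.
  have /proper_card/leq_trans : B r \proper [set y : 'I_n | col y == col r].
    apply/properP; split; first by apply/subsetP => y; rewrite !inE => /andP[].
    by exists r; rewrite !inE eqxx ?ltnn.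
  apply; rewrite -(card_ord (row m).+1).
  rewrite -(@card_in_imset _ _ (fun y : 'I_n => inord (row y) : 'I_(row m).+1)); first exact: max_card.
  move=> y z; rewrite !inE => /eqP cy /eqP cz /(congr1 val) /=.
  by rewrite !inordK ?ltnS ?mmax // => e; apply: cell_inj; rewrite ?cy.
have [q qP] := fin_all_exists Bcell.
have Bmono r r' : col r = col r' -> (U r < U r')%N -> (#|B r| < #|B r'|)%N.
  move=> ec Ur; apply: proper_card; apply/properP; split.
    by apply/subsetP => y; rewrite !inE ec => /andP[->] /= /ltn_trans; apply.
  by exists r; rewrite !inE ?ec eqxx ?ltnn.
have qinj : injective q.
  move=> r r' e.
  have [er ec] := qP r; have [er' ec'] := qP r'.
  have ec2 : col r = col r' by rewrite -ec -ec' e.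
  have eB : #|B r| = #|B r'| by rewrite -er -er' e.
  apply: Uinj => //; case: (ltngtP (U r) (U r')) => // lt.
    by have := Bmono _ _ ec2 lt; rewrite eB ltnn.
  by have := Bmono _ _ (esym ec2) lt; rewrite eB ltnn.
exists (perm qinj).
  by rewrite inE; apply/forallP => r; rewrite permE; case: (qP r) => _ ->.
by move=> r; rewrite permE; case: (qP r) => -> _.
Qed.

(** Pigeonhole on the Garnir belt: the upper row from column [col r1] on and the lower row up to
    that column hold one cell more than the upper row is long, while [g] keeps rows and so maps the
    belt into the columns of the upper row. *)
Lemma garnir_collision (g : 'S_n) r1 r2 :
    g \in row_group n lam -> col r1 = col r2 -> (row r1 < row r2)%N ->
  exists z z', [/\ z != z', col (g z) = col (g z'),
    (row z == row r1) && (col r1 <= col z)%N || (row z == row r2) && (col z <= col r1)%N &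
    (row z' == row r1) && (col r1 <= col z')%N || (row z' == row r2) && (col z' <= col r1)%N].
Proof.
move=> gR ec ltr; set i := row r1; set i' := row r2; set j := col r1.
have gRow r : row (g r) = row r by move: gR; rewrite inE => /forallP/(_ r)/eqP.
set k := nth 0 lam i.
have jk : (j < k)%N by exact: col_lt.
have jk' : (j < nth 0 lam i')%N by rewrite /j ec; exact: col_lt.
(* [h] enumerates the belt: indices up to [j] give the lower row, larger ones the upper row shifted
   by one, so that column [j] is met twice. *)
have /fin_all_exists[h hP] : forall a : 'I_k.+1, exists r,
    if (a <= j)%N then row r = i' /\ col r = a else row r = i /\ col r = a.-1.
  move=> a; case: leqP => aj; apply: cell_at; first exact: leq_ltn_trans aj jk'.
  by rewrite -ltnS prednK ?ltn_ord // (leq_ltn_trans _ aj).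
have hcol a : (col (g (h a)) < k)%N.
  apply: leq_trans (col_lt _) _; rewrite gRow.
  by have := hP a; case: leqP => _ [-> _] //; apply: part_le; apply: ltnW.
have kpos : (0 < k)%N by exact: leq_ltn_trans jk.
pose f a : 'I_k := Ordinal (hcol a).
have /injectivePn[a [b ab fab]] : ~~ injectiveb f.
  by apply/injectiveP => /leq_card; rewrite !card_ord ltnn.
have inZ c : (row (h c) == i) && (j <= col (h c))%N || (row (h c) == i') && (col (h c) <= j)%N.
  have := hP c; case: leqP => cj [-> ->]; first by rewrite eqxx cj orbT.
  by rewrite eqxx -ltnS prednK ?cj // (leq_ltn_trans _ cj).
exists (h a), (h b); split=> //; last by case: fab.
apply: contra ab => /eqP hab; apply/eqP/val_inj => /=.
have := hP a; have := hP b; rewrite hab.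
case: leqP => bj; case: leqP => aj [e1 e2] [e3 e4].
- by rewrite -e2 -e4.
- by move: ltr; rewrite -/i -/i' -e1 -e3 ltnn.
- by move: ltr; rewrite -/i -/i' -e1 -e3 ltnn.
by rewrite -(prednK (leq_ltn_trans _ aj)) // -(prednK (leq_ltn_trans _ bj)) // -e2 -e4.
Qed.

End Shape.

(** * Young symmetrizers *)

Section Fibers.
Variables (n : nat) (f : 'I_n -> nat).

(** With the row or the column function for [f] this is [row_group] or [col_group], so one group
    structure serves both. *)
Definition fiberwise : {set 'S_n} := [set p : 'S_n | [forall x, f (p x) == f x]].

Lemma fiberwiseP (p : 'S_n) : reflect (forall x, f (p x) = f x) (p \in fiberwise).
Proof.
by rewrite inE; apply: (iffP forallP) => fp x; [apply/eqP | rewrite fp].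
Qed.

Lemma fiberwise_group_set : group_set fiberwise.
Proof.
apply/group_setP; split=> [|p q /fiberwiseP fp /fiberwiseP fq].
  by apply/fiberwiseP => x; rewrite perm1.
by apply/fiberwiseP => x; rewrite permM fq.
Qed.
Canonical fiberwise_group := Group fiberwise_group_set.

Lemma fiberwise_tperm x y : f x = f y -> tperm x y \in fiberwise.
Proof. by move=> e; apply/fiberwiseP => z; case: tpermP => // ->. Qed.
End Fibers.

Section Symmetrizers.
Variables (n : nat) (lam : seq nat).
Hypothesis lamP : is_partition n lam.

Notation row r := (rowof lam (nat_of_ord r)).
Notation col r := (colof lam (nat_of_ord r)).
Notation R := (fiberwise_group (fun r : 'I_n => row r)).
Notation C := (fiberwise_group (fun r : 'I_n => col r)).

Section Operators.
Variables (d : nat) (rG : mx_representation algC (Sn n) d).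

Definition row_op : 'M_d := \sum_(p in R) rG p.
Definition col_op : 'M_d := \sum_(q in C) (-1) ^+ odd_perm q *: rG q.

Lemma reprM (s t : 'S_n) : rG (s * t)%g = rG s *m rG t.
Proof. by rewrite repr_mxM ?inE. Qed.

Lemma row_opMl p : p \in R -> rG p *m row_op = row_op.
Proof.
move=> pR; rewrite mulmx_sumr [RHS](reindex_inj (mulgI p)) /=.
by apply: eq_big => [q|q _]; rewrite ?reprM // groupMl.
Qed.

Lemma row_opMr p : p \in R -> row_op *m rG p = row_op.
Proof.
move=> pR; rewrite mulmx_suml [RHS](reindex_inj (mulIg p)) /=.
by apply: eq_big => [q|q _]; rewrite ?reprM // groupMr.
Qed.

Lemma col_opMl q : q \in C -> rG q *m col_op = (-1) ^+ odd_perm q *: col_op.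
Proof.
move=> qC; rewrite mulmx_sumr scaler_sumr [RHS](reindex_inj (mulgI q)) /=.
apply: eq_big => [p|p _]; first by rewrite groupMl.
rewrite -scalemxAr reprM scalerA odd_permM signr_addb mulrA -signr_addb addbb.
by rewrite mul1r.
Qed.

End Operators.

Lemma row_col_trivial s : s \in R -> s \in C -> s = 1%g.
Proof.
move=> /fiberwiseP sR /fiberwiseP sC; apply/permP => x; rewrite perm1.
by apply: (cell_inj (sR x) (sC x)).
Qed.

Lemma sum_row_perm (h : 'I_n -> nat) (q : 'S_n) : (\sum_x h (q x) = \sum_x h x)%N.
Proof. by rewrite [RHS](reindex_inj (@perm_inj _ q)). Qed.

(** [U y] is the row from which [g] brings [y]. By hypothesis [U] is injective on each column, so
    [column_sort] yields a column permutation [q], and [g * q] preserves rows. *)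
Lemma row_col_factor (g : 'S_n) :
    (forall x y : 'I_n, row x = row y -> col (g x) = col (g y) -> x = y) ->
  exists2 p, p \in R & exists2 q, q \in C & g = (p * q)%g.
Proof.
move=> gdist; pose U y := row ((g^-1)%g y).
have [|q qC qU] := column_sort lamP (U := U).
  move=> y y' ec eU; apply: (@perm_inj _ (g^-1)%g); apply: gdist => //.
  by rewrite !permKV.
(* Both sides rearrange the row function and have the same total, so the termwise inequality [qU] is
   an equality. *)
have eqU y : row (q y) = U y.
  have : (\sum_y (U y - row (q y)) == 0)%N.
    rewrite -(eqn_add2r (\sum_y row (q y))) -big_split /= add0n.
    under eq_bigr => z _ do rewrite subnK //.
    by rewrite (sum_row_perm (fun z => row z)) (sum_row_perm (fun z => row z)).
  rewrite sum_nat_eq0 => /forallP/(_ y); rewrite /= subn_eq0 => le.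
  by apply/eqP; rewrite eqn_leq le qU.
exists (g * q)%g.
  by apply/fiberwiseP => x; rewrite permM eqU /U permK.
by exists (q^-1)%g; rewrite ?groupV // -mulgA mulgV mulg1.
Qed.

(* von Neumann's lemma; the scalar does not depend on the representation. *)
Lemma row_col_sandwich : exists l : 'S_n -> algC,
  forall g d (rG : mx_representation algC (Sn n) d),
  row_op rG *m rG g *m col_op rG = l g *: (row_op rG *m col_op rG).
Proof.
suff H (g : 'S_n) : exists c : algC, forall d (rG : mx_representation algC (Sn n) d),
    row_op rG *m rG g *m col_op rG = c *: (row_op rG *m col_op rG).
  by have [l lP] := fin_all_exists H; exists l.
(* If [g] separates the columns of cells from a common row, it factors as [p * q] and the scalar is
   the sign of [q]; otherwise the scalar is 0. *)
have [] := boolP [exists x : 'I_n, exists y : 'I_n,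
    [&& x != y, row x == row y & col (g x) == col (g y)]]; last first.
  move=> gdist; have [|p pR [q qC ->]] := @row_col_factor g.
    move=> x y er ec; apply/eqP; apply: contraR gdist => xy.
    by apply/existsP; exists x; apply/existsP; exists y; rewrite xy er ec !eqxx.
  exists ((-1) ^+ odd_perm q) => d rG.
  by rewrite reprM mulmxA row_opMr // -mulmxA col_opMl // -scalemxAr.
case/existsP=> x /existsP[y /and3P[xy /eqP er /eqP ec]]; exists 0 => d rG.
set M := LHS; suff : M = - M.
  move/eqP; rewrite -addr_eq0 -mulr2n -scaler_nat scaler_eq0 pnatr_eq0 /=.
  by move/eqP->; rewrite scale0r.
(* The transposition is absorbed by the row symmetrizer, its conjugate by [g]
   changes the sign of the column antisymmetrizer. *)
rewrite {1}/M -(row_opMr rG (p := tperm x y)) ?fiberwise_tperm //.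
rewrite -!mulmxA [rG (tperm x y) *m _]mulmxA -reprM.
have -> : (tperm x y * g = g * tperm (g x) (g y))%g.
  by rewrite -tpermJ /conjg mulgA mulgA mulgV mul1g.
rewrite reprM -!mulmxA col_opMl ?fiberwise_tperm // odd_tperm (inj_eq perm_inj) xy.
by rewrite expr1 scaleN1r !mulmxN /M mulmxA.
Qed.

(** Expand the inner column-times-row product into group elements and apply the sandwich lemma to
    each. One [k] serves all representations, in particular both the regular one and the
    component. *)
Lemma young_quasi_idem : exists k : algC, forall d (rG : mx_representation algC (Sn n) d),
  (row_op rG *m col_op rG) *m (row_op rG *m col_op rG) = k *: (row_op rG *m col_op rG).
Proof.
have [l lP] := row_col_sandwich.
exists (\sum_(q in C) \sum_(p in R) (-1) ^+ odd_perm q * l (q * p)%g) => d rG.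
have := fun g => lP g d rG.
have : col_op rG *m row_op rG =
    \sum_(q in C) \sum_(p in R) (-1) ^+ odd_perm q *: rG (q * p)%g.
  rewrite mulmx_suml; apply: eq_bigr => q _; rewrite mulmx_sumr.
  by apply: eq_bigr => p _; rewrite -scalemxAl reprM.
move: (row_op rG) (col_op rG) => A B BA ABl; rewrite mulmxA -(mulmxA A) BA.
rewrite mulmx_sumr mulmx_suml scaler_suml; apply: eq_bigr => q _.
rewrite mulmx_sumr mulmx_suml scaler_suml; apply: eq_bigr => p _.
by rewrite -scalemxAr -scalemxAl ABl scalerA.
Qed.

End Symmetrizers.

(* A full-rank factorization [M = C *m R] turns [M *m M = k *: M] into [R *m C = k%:M]. *)
Lemma trace_quasi_idem (F : fieldType) m (M : 'M[F]_m) (k : F) :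
  M *m M = k *: M -> \tr M = k * (\rank M)%:R.
Proof.
move=> MM; rewrite -{1}(mulmx_base M) mxtrace_mulC.
suff -> : row_base M *m col_base M = k%:M by rewrite mxtrace_scalar mulr_natr.
have := MM; rewrite -{1 2 3}(mulmx_base M) -mulmxA [row_base M *m _]mulmxA.
rewrite scalemxAr => /(row_full_inj (col_base_full M)).
by rewrite -mul_scalar_mx => /(row_free_inj (row_base_free M)).
Qed.

(** * The character of the Specht module *)

(** [P] is a projection onto [U]. Factor it through [U] and rotate the trace. *)
Lemma submod_trace (F : fieldType) (gT : finGroupType) (G : {group gT}) d
    (rG : mx_representation F G d) (U P : 'M_d) (Umod : mxmodule rG U) g :
  g \in G -> (P <= U)%MS -> U *m P = U ->
  \tr (submod_mx Umod g) = \tr (P *m rG g).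
Proof.
move=> Gg PU UP; have fixU m (W : 'M_(m, d)) : (W <= U)%MS -> W *m P = W.
  by case/submxP=> D ->; rewrite -mulmxA UP.
rewrite -(in_submodK PU) val_submodE in_submodE -[_ *m val_submod _ *m _]mulmxA.
rewrite [RHS]mxtrace_mulC mulmxA fixU; last first.
  by apply: mxmodule_trans => //; rewrite val_submod1.
by rewrite /submod_mx in_submodE.
Qed.

Section SpechtCharacter.
Variables (n : nat) (lam : seq nat).
Hypothesis lamP : is_partition n lam.

Notation R := (row_group n lam).
Notation C := (col_group n lam).
Notation reg := (regular_repr algC (Sn n)).
Notation young := (young_symmetrizer n lam).

Definition young_coef (g : 'S_n) : algC :=
  \sum_(p in R) \sum_(q in C) ((p * q)%g == g)%:R * (-1) ^+ odd_perm q.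

Lemma young_coefE d (rG : mx_representation algC (Sn n) d) :
  \sum_g young_coef g *: rG g = row_op lam rG *m col_op lam rG.
Proof.
rewrite mulmx_suml; under eq_bigr => g _ do rewrite scaler_suml.
rewrite exchange_big /=; apply: eq_bigr => p _; rewrite mulmx_sumr.
under eq_bigr => g _ do rewrite scaler_suml.
rewrite exchange_big /=; apply: eq_bigr => q _.
rewrite (bigD1 (p * q)%g) //= eqxx mul1r big1 ?addr0 => [|g /negbTE pq].
  by rewrite -scalemxAr reprM.
by rewrite eq_sym pq mul0r scale0r.
Qed.

(** The row and column groups meet trivially, so only [p = q = 1] contributes. *)
Lemma young_coef1 : young_coef 1 = 1.
Proof.
have R1 : (1%g : 'S_n) \in R by exact: group1 (fiberwise_group _).
have C1 : (1%g : 'S_n) \in C by exact: group1 (fiberwise_group _).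
rewrite /young_coef (bigD1 1%g) //= (bigD1 1%g) //= mulg1 eqxx odd_perm1 mulr1.
rewrite !big1 ?addr0 // => [p /andP[pR p1]|q /andP[qC /negbTE q1]]; last first.
  by rewrite mul1g q1 mul0r.
apply: big1 => q qC; case: eqP => [pq|]; last by rewrite mul0r.
case/eqP: p1; apply: (row_col_trivial pR).
by rewrite -(mulgK q p) pq mul1g; rewrite (groupV (fiberwise_group _)).
Qed.

Lemma reg_mulmxE m (v : 'M_(m, #|Sn n|)) g i j :
  (v *m reg g) i j = v i (gring_index (Sn n) (enum_val j * g^-1)%g).
Proof.
rewrite mxE (bigD1 (gring_index (Sn n) (enum_val j * g^-1)%g)) //= big1 ?addr0.
  by rewrite !mxE gring_indexK ?inE // mulgKV gring_valK !eqxx mulr1.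
move=> k kj; rewrite !mxE eqxx /=; case: eqP => [e|]; last by rewrite mulr0.
case/eqP: kj; rewrite e gring_indexK ?inE // mulgK gring_valK //.
Qed.

(** The matrix of left multiplication by the Young symmetrizer on the group algebra. It commutes
    with the right regular action, and its image is the Specht module. *)
Definition left_young : 'M[algC]_#|Sn n| :=
  \matrix_(i < #|Sn n|) (young *m reg (enum_val i)).

Lemma left_young_reg i g :
  row i (left_young *m reg g) = young *m reg (enum_val i * g)%g.
Proof. by rewrite row_mul rowK -mulmxA reprM. Qed.

Lemma left_young_comm g : reg g *m left_young = left_young *m reg g.
Proof.
apply/row_matrixP => i; rewrite left_young_reg row_mul rowK -rowE rowK.
by rewrite gring_indexK ?inE.
Qed.

Lemma sum_Sn (V : zmodType) (F : 'S_n -> V) :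
  \sum_(i < #|Sn n|) F (enum_val i) = \sum_g F g.
Proof. by rewrite -(big_enum_val F) /=; apply: eq_bigl => g; rewrite inE. Qed.

(** Writing e for the symmetrizer, left and right multiplication by e agree on e itself. This
    carries quasi-idempotence over to [left_young]. *)
Lemma young_left_young : young *m left_young = young *m (row_op lam reg *m col_op lam reg).
Proof.
rewrite mulmx_sum_row -young_coefE mulmx_sumr.
rewrite -(sum_Sn (fun g => young *m (young_coef g *: reg g))).
by apply: eq_bigr => i _; rewrite rowK mxE -scalemxAr.
Qed.

Lemma young_orbit :
  young = 'e_(gring_index (Sn n) 1%g) *m (row_op lam reg *m col_op lam reg).
Proof.
rewrite -young_coefE mulmx_sumr; apply/rowP => j.
have -> : young 0 j = young_coef (enum_val j) by rewrite mxE.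
rewrite summxE (bigD1 (enum_val j)) //= big1 ?addr0 => [|g /negbTE gj].
  rewrite -scalemxAr mxE reg_mulmxE mulgV mxE !eqxx mulr1.
  by [].
rewrite -scalemxAr mxE reg_mulmxE mxE eqxx /=; case: eqP => [e|]; last by rewrite mulr0.
have /esym/eqP : enum_val (gring_index (Sn n) (enum_val j * g^-1)) = (enum_val j * g^-1)%g.
  by rewrite gring_indexK ?inE.
rewrite e gring_indexK ?inE // -eq_mulgV1 => /eqP e2.
by rewrite e2 eqxx in gj.
Qed.

Lemma left_young_module : (left_young :=: cyclic_mx reg young)%MS.
Proof.
apply/eqmxP/andP; split.
  apply/row_subP => i; rewrite rowK.
  by apply: mxmodule_trans (cyclic_mx_module _ _) _ (cyclic_mx_id _ _); rewrite inE.
apply: cyclic_mx_sub.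
  apply/mxmoduleP => g _; rewrite -left_young_comm; exact: submxMl.
have -> : young = row (gring_index (Sn n) 1%g) left_young; last exact: row_sub.
by rewrite rowK gring_indexK ?group1 // repr_mx1 mulmx1.
Qed.

(** The diagonal entry at h is the coefficient of h in e h g, which is that of e at
    [h * g^-1 * h^-1]. *)
Lemma left_young_trace g :
  \tr (left_young *m reg g) = \sum_h young_coef (h * g^-1 * h^-1)%g.
Proof.
rewrite -(sum_Sn (fun h => young_coef (h * g^-1 * h^-1)%g)); apply: eq_bigr => i _.
have -> : (left_young *m reg g) i i = row i (left_young *m reg g) 0 i by rewrite [RHS]mxE.
rewrite left_young_reg reg_mulmxE mxE gring_indexK ?inE //.
by rewrite invMg mulgA.
Qed.

(** [k] times the rank of [left_young] is its trace, and this trace is the group order because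
    [young_coef 1 = 1]; hence [k] is nonzero. *)
Lemma young_idem_scalar : exists2 k : algC, k != 0 &
  (left_young *m left_young = k *: left_young) /\
  forall d (rG : mx_representation algC (Sn n) d),
  (row_op lam rG *m col_op lam rG) *m (row_op lam rG *m col_op lam rG)
    = k *: (row_op lam rG *m col_op lam rG).
Proof.
have [k kP] := young_quasi_idem lamP; have LL : left_young *m left_young = k *: left_young.
  apply/row_matrixP => i; rewrite row_mul rowK -mulmxA left_young_comm mulmxA.
  suff -> : young *m left_young = k *: young by rewrite linearZ /= rowK scalemxAl.
  by rewrite young_left_young {1}young_orbit -mulmxA kP -scalemxAr -young_orbit.
exists k => //; apply: contraTneq isT => k0.
have := trace_quasi_idem LL; rewrite k0 mul0r -[left_young]mulmx1 -(repr_mx1 reg).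
rewrite left_young_trace.
under eq_bigr => h _ do rewrite invg1 mulg1 mulgV young_coef1.
rewrite sumr_const => /eqP; rewrite pnatr_eq0 => /eqP/card0_eq/(_ 1%g).
by rewrite inE.
Qed.

(** [k^-1 *: left_young] projects onto the Specht module, which yields its character as a sum over
    conjugates. The character of [rG] is a class function, so every conjugate contributes the trace
    of the symmetrizer on [rG], that is, [k] times its rank. *)
Lemma cfdot_specht d (rG : mx_representation algC (Sn n) d) :
  '[cfRepr rG, cfRepr (specht_repr n lam)]
    = (\rank (row_op lam rG *m col_op lam rG))%:R.
Proof.
have [k k0 [LL kP]] := young_idem_scalar.
have spechtE g : cfRepr (specht_repr n lam) g
    = k^-1 * \sum_h young_coef (h * g^-1 * h^-1)%g.
  rewrite cfunE /= inE mulr1n -left_young_trace -mxtraceZ scalemxAl.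
  apply: submod_trace; rewrite ?inE //.
    by rewrite -left_young_module scalemx_sub.
  have /submxP[D ->] : (cyclic_mx reg young <= left_young)%MS by rewrite left_young_module.
  by rewrite -mulmxA -scalemxAr LL scalerA mulVf // scale1r.
have trE : \tr (row_op lam rG *m col_op lam rG) = \sum_g young_coef g * cfRepr rG g.
  rewrite -young_coefE raddf_sum /=; apply: eq_bigr => g _.
  by rewrite mxtraceZ cfunE inE mulr1n.
have -> : (\rank (row_op lam rG *m col_op lam rG))%:R
    = k^-1 * \tr (row_op lam rG *m col_op lam rG).
  by rewrite (trace_quasi_idem (kP _ _)) mulKf.
rewrite cfdotE trE.
under eq_bigr => g _ do rewrite -char_inv ?cfRepr_char // spechtE invgK mulrCA.
rewrite -mulr_sumr mulrCA; congr (_ * _).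
under eq_bigr => g _ do rewrite mulr_sumr.
rewrite exchange_big /=.
have E h : \sum_(g in Sn n) cfRepr rG g * young_coef (h * g * h^-1)%g
    = \sum_g young_coef g * cfRepr rG g.
  rewrite (reindex_inj (conjg_inj h)) /=; apply: eq_big => [g|g _]; first by rewrite inE.
  rewrite cfunJ ?inE // mulrC; congr (young_coef _ * _).
  by rewrite conjgE !mulgA mulgV mul1g mulgK.
under eq_bigr => h _ do rewrite E.
rewrite sumr_const -[X in _ * X]mulr_natl mulrA cardsT mulVf ?mul1r // pnatr_eq0.
by rewrite -lt0n; apply/card_gt0P; exists 1%g.
Qed.

End SpechtCharacter.

(** * The Young symmetrizer on signed fillings *)

(* Termwise, [(w (h r) - w r) * (F r - v) >= 0], and the [v] part sums to zero. *)
Lemma shift_sum n (w F : 'I_n -> nat) (h : 'S_n) (v : nat) :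
    (forall r, (w r <= w (h r) /\ v <= F r) \/ (w (h r) <= w r /\ F r <= v))%N ->
  (\sum_r w r * F r <= \sum_r w (h r) * F r)%N /\
  ((\sum_r w (h r) * F r <= \sum_r w r * F r)%N ->
     forall r, w (h r) = w r \/ F r = v).
Proof.
move=> H; have H1 r : (w r * F r + w (h r) * v <= w (h r) * F r + w r * v)%N.
  by case: (H r) => -[a b]; nia.
have [le1 eq1] := leqif_sum (P := predT) (fun r _ => leqif_eq (H1 r)).
have E : (\sum_r w (h r) * v = \sum_r w r * v)%N.
  by rewrite [RHS](reindex_inj (@perm_inj _ h)).
move: le1 eq1; rewrite !big_split /= E leq_add2r eqn_add2r => le1 eq1.
split=> // le2 r; have /eqP : (\sum_r w r * F r = \sum_r w (h r) * F r)%N.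
  by apply/eqP; rewrite eqn_leq le1.
rewrite eq1 => /forallP/(_ r)/eqP {}H1; case: (H r) => -[a b]; nia.
Qed.

(** Let [S] be the entries smaller than [T r] in the line of [r]. By sortedness they sit at
    positions below [i], where [q] keeps values; if [T (q r)] were smaller too, [q] would inject [S]
    together with [r] into [S]. *)
Lemma sorted_first_diff n (f w T : 'I_n -> nat) (q : 'S_n) i :
    q \in fiberwise f ->
    (forall r r', f r = f r' -> (w r <= w r')%N -> (T r <= T r')%N) ->
    (forall r, (w r < i)%N -> T (q r) = T r) ->
  forall r, w r = i -> (T r <= T (q r))%N.
Proof.
move=> /fiberwiseP fq Ts Tq r wr; rewrite leqNgt; apply/negP => lt.
pose S := [set z : 'I_n | (f z == f r) && (T z < T r)%N].
have : q @: (r |: S) \subset S.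
  apply/subsetP => _ /imsetP[z zS ->]; move: zS; rewrite !inE.
  case/orP=> [/eqP->|/andP[/eqP fz Tz]]; first by rewrite fq eqxx.
  rewrite fq fz eqxx Tq // -wr ltnNge; apply: contraL Tz => le.
  by rewrite -leqNgt; apply: Ts.
move/subset_leq_card; rewrite card_imset; last exact: perm_inj.
by rewrite cardsU1 !inE ltnn andbF /= add1n ltnn.
Qed.

Section SignedFillings.
Variables (n : nat) (lam : seq nat).
Hypothesis lamP : is_partition n lam.
Variables (X : finType) (act : X -> 'S_n -> X) (c : 'S_n -> X -> algC).
Hypotheses (act1 : forall x, act x 1%g = x)
  (actM : forall x g h, act x (g * h)%g = act (act x g) h)
  (c1 : forall x, c 1%g x = 1)
  (cM : forall g h x, c (g * h)%g x = c g x * c h (act x g)).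
(** [lab x r] is the label in cell [r]; [rk] orders labels by numbers, so that they can be weighted
    and summed; [par] marks the labels whose exchange costs a sign. *)
Variables (L : eqType) (lab : X -> 'I_n -> L) (rk : L -> nat) (par : pred L).
Hypotheses (rk_inj : injective rk)
  (lab_act : forall x g r, lab (act x g) (g r) = lab x r)
  (lab_inj : forall x y, lab x =1 lab y -> x = y)
  (c_tperm : forall x r r', r != r' -> lab x r = lab x r' ->
     c (tperm r r') x = (-1) ^+ par (lab x r)).

Variable rG : mx_representation algC (Sn n) #|X|.
Hypothesis rGE : forall g, rG g = spr_mx act c g.

Notation row r := (rowof lam (nat_of_ord r)).
Notation col r := (colof lam (nat_of_ord r)).
Notation R := (fiberwise_group (fun r : 'I_n => row r)).
Notation C := (fiberwise_group (fun r : 'I_n => col r)).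
Notation F x r := (rk (lab x r)).
Notation A := (row_op lam rG).
Notation B := (col_op lam rG).
Notation evec x := ('e_(enum_rank x) : 'rV[algC]_#|X|).

(** The tableau conditions on numbered cells, with monotonicity between any two cells of a line, as
    the sorting arguments need it. *)
Definition semistandard (x : X) : bool :=
  [&& [forall r : 'I_n, forall r' : 'I_n,
         ((row r == row r') && (col r <= col r')%N) ==> (F x r <= F x r')%N],
      [forall r : 'I_n, forall r' : 'I_n,
         ((col r == col r') && (row r <= row r')%N) ==> (F x r <= F x r')%N],
      [forall r : 'I_n, forall r' : 'I_n,
         [&& r != r', lab x r == lab x r' & ~~ par (lab x r)] ==> (col r != col r')] &
      [forall r : 'I_n, forall r' : 'I_n,
         [&& r != r', lab x r == lab x r' & par (lab x r)] ==> (row r != row r')]].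

Lemma semistandardP x : reflect
  [/\ forall r r' : 'I_n, row r = row r' -> (col r <= col r')%N -> (F x r <= F x r')%N,
      forall r r' : 'I_n, col r = col r' -> (row r <= row r')%N -> (F x r <= F x r')%N,
      forall r r' : 'I_n, r != r' -> lab x r = lab x r' -> col r = col r' -> par (lab x r) &
      forall r r' : 'I_n, r != r' -> lab x r = lab x r' -> row r = row r' -> ~~ par (lab x r)]
  (semistandard x).
Proof.
apply: (iffP and4P) => -[H1 H2 H3 H4]; split.
- by move=> r r' er lec; move/forallP/(_ r)/forallP/(_ r'): H1; rewrite er eqxx lec.
- by move=> r r' er lec; move/forallP/(_ r)/forallP/(_ r'): H2; rewrite er eqxx lec.
- move=> r r' nr el ec; move/forallP/(_ r)/forallP/(_ r'): H3.
  by rewrite nr el ec !eqxx /= implybF negbK.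
- move=> r r' nr el ec; move/forallP/(_ r)/forallP/(_ r'): H4.
  by rewrite nr el ec !eqxx /= implybF.
- by do 2!apply/forallP => ?; apply/implyP => /andP[/eqP ? ?]; apply: H1.
- by do 2!apply/forallP => ?; apply/implyP => /andP[/eqP ? ?]; apply: H2.
- apply/forallP => r; apply/forallP => r'; apply/implyP => /and3P[nr /eqP el].
  by apply: contraNneq => ec; apply: H3 el ec.
apply/forallP => r; apply/forallP => r'; apply/implyP => /and3P[nr /eqP el].
by apply: contraTneq => ec; apply: H4 el ec.
Qed.

Lemma basis_act x g : evec x *m rG g = c g x *: evec (act x g).
Proof.
rewrite -rowE rGE; apply/rowP => j; rewrite !mxE enum_rankK eqxx /=; congr (_ * _%:R).
by rewrite -(inj_eq enum_val_inj) enum_rankK eq_sym.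
Qed.

Lemma act_fix x (g : 'S_n) : (forall r, lab x (g r) = lab x r) -> act x g = x.
Proof.
move=> gx; apply: lab_inj => r; rewrite -(permKV g r) lab_act.
by rewrite gx.
Qed.

Lemma lab_fix x g r : act x g = x -> lab x (g r) = lab x r.
Proof. by move=> gx; rewrite -{1}gx lab_act. Qed.

(* [f] is the row or the column function; the parity of repeated labels in a row
   (column) of a semistandard filling is constant. *)
Lemma stabilizer_sign x f b (g : 'S_n) :
    (forall r r' : 'I_n, r != r' -> f r = f r' -> lab x r = lab x r' -> par (lab x r) = b) ->
    g \in fiberwise_group f -> act x g = x ->
  c g x = if b then (-1) ^+ odd_perm g else 1.
Proof.
move=> bP; have [N] := ubnP #|[set r | g r != r]|; elim: N g => // N IH g ltN gf gx.
have [/existsP[r gr]|/existsPn gid] := boolP [exists r, g r != r]; last first.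
  suff -> : g = 1%g by rewrite c1 odd_perm1 if_same.
  by apply/permP => r; rewrite perm1; apply/eqP; rewrite -[_ == _]negbK.
pose t := tperm r (g r); pose h := (g * t)%g.
have frg : f r = f (g r) by move/fiberwiseP: gf => ->.
have lrg : lab x r = lab x (g r) by rewrite lab_fix.
have tf : t \in fiberwise_group f by apply: fiberwise_tperm.
have tx : act x t = x by apply: act_fix => y; rewrite /t; case: tpermP => // ->.
have hx : act x h = x by rewrite actM gx.
have gE : g = (h * t)%g by rewrite /h -mulgA tperm2 mulg1.
have rgr : r != g r by rewrite eq_sym.
have ct : c t x = (-1) ^+ b by rewrite c_tperm // (bP r (g r)).
rewrite gE cM hx ct (IH h) ?groupM //; last first.
  rewrite -ltnS; apply: leq_trans ltN; rewrite ltnS; apply: proper_card.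
  apply/properP; split; last by exists r; rewrite !inE ?gr // permM tpermR eqxx.
  apply/subsetP => y; rewrite !inE; apply: contra => /eqP gy; rewrite permM gy.
  case: tpermP => // ey.
    by rewrite -ey gy eqxx in gr.
  by move: gy; rewrite ey => /perm_inj ->.
rewrite odd_permM odd_tperm rgr; case: (b); rewrite ?expr0 ?mulr1 //.
by rewrite signr_addb.
Qed.

(** Exchanging two cells labelled [l] fixes the filling without a sign. Such exchanges reduce [h] to
    a row permutation, which the row symmetrizer absorbs. *)
Lemma swap_equal_labels x l (h : 'S_n) :
    ~~ par l -> (forall r : 'I_n, row (h r) != row r -> lab x r = l) ->
  evec x *m rG h *m A = evec x *m A.
Proof.
move=> lpar; have [N] := ubnP #|[set r : 'I_n | row (h r) != row r]|.
elim: N h => // N IH h ltN hl.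
have [/existsP[r hr]|/existsPn hR] := boolP [exists r : 'I_n, row (h r) != row r]; last first.
  rewrite -mulmxA row_opMl //; apply/fiberwiseP => r.
  by apply/eqP; rewrite -[_ == _]negbK.
(* [h] brings [r] into the row [K] from outside, so by counting some cell of [K] must leave it.
   Precomposing with the swap of [r] and [r'] then keeps [r'] in its row. *)
have [r' er' hr'] : exists2 r' : 'I_n, row r' = row (h r) & row (h r') != row r'.
  pose K := [set y : 'I_n | row y == row (h r)].
  have /subsetPn[r'] : ~~ (K \subset h @^-1: K).
    apply/negP => sK.
    have : r |: K \subset h @^-1: K by rewrite subUset sK sub1set !inE eqxx.
    move/subset_leq_card; rewrite cardsU1 !inE eq_sym (negbTE hr) /=.
    by rewrite card_preimset ?ltnn //; apply: perm_inj.
  by rewrite !inE => /eqP er nr; exists r' => //; rewrite er.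
have rr' : r != r' by apply: contraNneq hr => e; rewrite -er' -e.
pose t := tperm r r'; have elab : lab x r = lab x r' by rewrite !hl.
have ct : c t x = 1 by rewrite c_tperm // hl // (negbTE lpar).
have tx : act x t = x by apply: act_fix => y; rewrite /t; case: tpermP => // ->.
have ext : evec x *m rG t = evec x by rewrite basis_act ct tx scale1r.
rewrite -{1}ext -[evec x *m _ *m _]mulmxA -reprM.
have sub (y : 'I_n) : row ((t * h)%g y) != row y -> row (h y) != row y /\ y != r'.
  rewrite permM /t; case: tpermP => [->|->|yr /eqP yr'] H; split=> //.
  by move: H; rewrite er' !eqxx.
rewrite IH // => [|y /sub[hy _]]; last exact: hl.
rewrite -ltnS; apply: leq_trans ltN; rewrite ltnS; apply: proper_card.
apply/properP; split; first by apply/subsetP => y; rewrite !inE => /sub[].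
by exists r'; rewrite !inE // permM tpermR er' eqxx.
Qed.

(** * Spanning: Garnir straightening *)

Section Straightening.

Definition standard_span : 'M_#|X| :=
  (\sum_(y | semistandard y) <<evec y *m (A *m B)>>)%MS.
Notation W := standard_span.

(** Each row permutation [g] sends two cells of the belt to one column. Their transposition is
    absorbed by the sum over [Z], while its conjugate by [g] negates the column antisymmetrizer. *)
Lemma garnir_vanish (r1 r2 : 'I_n) (Z : {set 'I_n}) :
    col r1 = col r2 -> (row r1 < row r2)%N ->
    Z = [set r : 'I_n | (row r == row r1) && (col r1 <= col r)%N
                   || (row r == row r2) && (col r <= col r1)%N] ->
  (\sum_(h | perm_on Z h) rG h) *m (A *m B) = 0.
Proof.
move=> ec lt ZE; rewrite mulmxA [_ *m A]mulmx_sumr mulmx_suml big1 // => g gR.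
have [z [z' [zz' ecg zZ z'Z]]] := garnir_collision lamP gR ec lt.
set S := \sum_(h | _) _; set M := LHS; suff : M = - M.
  move/eqP; rewrite -addr_eq0 -mulr2n -scaler_nat scaler_eq0 pnatr_eq0 /=.
  by move/eqP->.
have tZ : perm_on Z (tperm z z').
  by apply/subsetP => y; rewrite inE ZE; case: tpermP => [->|->|_ _]; rewrite ?eqxx ?inE.
have St : S = S *m rG (tperm z z').
  rewrite mulmx_suml /S (reindex_inj (mulIg (tperm z z'))) /=.
  apply: eq_big => [h|h _]; last by rewrite reprM.
  apply/idP/idP => hZ; last exact: perm_onM.
  by rewrite -[h](mulgK (tperm z z')) tpermV perm_onM.
rewrite {1}/M St -[S *m _ *m _]mulmxA -reprM.
have -> : (tperm z z' * g = g * tperm (g z) (g z'))%g.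
  by rewrite -tpermJ /conjg mulgA mulgA mulgV mul1g.
rewrite reprM -!mulmxA col_opMl ?fiberwise_tperm // odd_tperm (inj_eq perm_inj) zz'.
by rewrite expr1 scaleN1r !mulmxN /M mulmxA.
Qed.

Lemma weight_act (w : 'I_n -> nat) x (h : 'S_n) :
  (\sum_r w r * F (act x h) r = \sum_r w (h r) * F x r)%N.
Proof.
by rewrite (reindex_inj (@perm_inj _ h)) /=; apply: eq_bigr => r _; rewrite lab_act.
Qed.

(* A counterexample maximizing first [K1], then [K2], has no row inversion (swapping
   it raises [K2]); the Garnir relation at a column violation expresses it by
   fillings with larger [K1]. *)
Lemma straighten x : (evec x *m (A *m B) <= W)%MS.
Proof.
pose bad y := ~~ (evec y *m (A *m B) <= W)%MS.
rewrite -[(_ <= _)%MS]negbK -/(bad x); apply/negP => xbad.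
pose K1 y := (\sum_(r < n) row r * F y r)%N.
pose K2 y := (\sum_(r < n) col r * F y r)%N.
have [y ybad ymax1] : exists2 y, bad y & forall z, bad z -> (K1 z <= K1 y)%N.
  by exists [arg max_(y > x | bad y) K1 y]; case: arg_maxnP.
have [z /andP[zbad /eqP Kz] zmax2] : exists2 z, bad z && (K1 z == K1 y) &
    forall u, bad u && (K1 u == K1 y) -> (K2 u <= K2 z)%N.
  exists [arg max_(z > y | bad z && (K1 z == K1 y)) K2 z]; case: arg_maxnP => //;
  by rewrite ?ybad eqxx.
have zmax1 u : bad u -> (K1 u <= K1 z)%N by rewrite Kz; apply: ymax1.
move: zmax2; rewrite -Kz => {x xbad y ybad ymax1 Kz} zmax2.
have actW h : ~~ bad (act z h) -> (evec z *m rG h *m (A *m B) <= W)%MS.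
  by rewrite negbK basis_act -scalemxAl => /scalemx_sub->.
have rowW p : p \in R -> evec z *m (A *m B) = evec z *m rG p *m (A *m B).
  by move=> pR; rewrite -mulmxA [rG p *m _]mulmxA row_opMl.
have row_sorted (r r' : 'I_n) : row r = row r' -> (col r < col r')%N -> (F z r <= F z r')%N.
  move=> er ltc; rewrite leqNgt; apply/negP => ltF; set t := tperm r r'.
  have tR : t \in R by apply: fiberwise_tperm.
  have tbad : bad (act z t) by apply: contraNT zbad => /actW; rewrite -rowW.
  (* The swap moves the larger entry to the right, so [K2] cannot drop; maximality forces equality,
     which contradicts both strict inequalities. *)
  have [le1 eq1] : (K2 z <= \sum_y col (t y) * F z y)%N /\
      ((\sum_y col (t y) * F z y <= K2 z)%N -> forall y, col (t y) = col y \/ F z y = F z r').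
    apply: (@shift_sum n (fun y => col y)) => y; rewrite /t; case: tpermP => [->|->|_ _].
    - by left; split; apply: ltnW.
    - by right; split=> //; apply: ltnW.
    by case: (leqP (F z r') (F z y)) => [?|/ltnW ?]; [left | right].
  have K1t : K1 (act z t) = K1 z.
    rewrite /K1 weight_act; apply: eq_bigr => y _.
    by move/fiberwiseP: tR => ->.
  have := zmax2 (act z t); rewrite tbad K1t eqxx => /(_ isT).
  rewrite {1}/K2 weight_act => /eq1/(_ r); rewrite tpermL => -[e1|e1].
    by rewrite e1 ltnn in ltc.
  by rewrite e1 ltnn in ltF.
have row_odd (r r' : 'I_n) : r != r' -> lab z r = lab z r' -> row r = row r' -> ~~ par (lab z r).
  move=> rr' el er; apply/negP => odd_r; set t := tperm r r'.
  have tR : t \in R by apply: fiberwise_tperm.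
  have tz : act z t = z by apply: act_fix => y; rewrite /t; case: tpermP => // ->.
  have := rowW _ tR; rewrite basis_act c_tperm // odd_r tz expr1 scaleN1r mulNmx.
  move/eqP; rewrite -addr_eq0 -mulr2n -scaler_nat scaler_eq0 pnatr_eq0 /= => /eqP e0.
  by move: zbad; rewrite /bad e0 sub0mx.
have col_strict (r1 r2 : 'I_n) : col r1 = col r2 -> (row r1 < row r2)%N ->
    (F z r2 <= F z r1)%N -> (lab z r1 = lab z r2 -> ~~ par (lab z r1)) -> False.
  move=> ec lt leF eqF.
  set Z := [set r : 'I_n | (row r == row r1) && (col r1 <= col r)%N
                        || (row r == row r2) && (col r <= col r1)%N].
  have van := garnir_vanish ec lt (erefl Z).
  have keep h : perm_on Z h -> (evec z *m rG h *m (A *m B) <= W)%MS \/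
      evec z *m rG h *m (A *m B) = evec z *m (A *m B).
    move=> hZ; have [hbad|/actW ?] := boolP (bad (act z h)); [right | by left].
    (* Sorted rows put the upper belt entries at or above [v] and the lower ones at or below it.
       Permuting the belt can thus only raise [K1], and if the result is still bad, maximality
       leaves only entries equal to [v] free to change rows. *)
    have shift v : (F z r2 <= v <= F z r1)%N -> forall r : 'I_n, row (h r) = row r \/ F z r = v.
      case/andP=> v2 v1.
      have [|_ H] := @shift_sum n (fun y => row y) (fun y => F z y) h v.
        move=> r; have [rZ|rZ] := boolP (r \in Z); last first.
          rewrite (out_perm hZ rZ).
          by case: (leqP v (F z r)) => [?|/ltnW ?]; [left | right].
        have := rZ; have := rZ; rewrite -{1}(perm_closed _ hZ) !inE.
        move=> hrZ rZ'; case/orP: rZ' => /andP[/eqP er lec]; [left | right]; split.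
        - by rewrite er; case/orP: hrZ => /andP[/eqP-> _] //; apply: ltnW.
        - apply: leq_trans v1 _; move: lec; rewrite leq_eqVlt => /orP[/eqP ecr|].
            by rewrite (cell_inj er (esym ecr)).
          by apply: row_sorted.
        - by rewrite er; case/orP: hrZ => /andP[/eqP-> _] //; apply: ltnW.
        - apply: leq_trans v2; move: lec; rewrite -/(col r1) ec leq_eqVlt => /orP[/eqP ecr|].
            by rewrite (cell_inj er ecr).
          by apply: row_sorted.
      by apply: H; rewrite -(weight_act (fun y : 'I_n => row y)); apply: zmax1.
    rewrite !mulmxA; congr (_ *m _).
    (* The two extreme thresholds: if they coincide, all cells changing rows share one even label;
       if not, no cell changes its row. *)
    have s1 := shift _ (introT andP (conj leF (leqnn _))).
    have s2 := shift _ (introT andP (conj (leqnn _) leF)).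
    have [eF|neF] := eqVneq (F z r1) (F z r2).
      have el := rk_inj eF; apply: (swap_equal_labels (eqF el)) => r nr.
      by apply: rk_inj; case: (s1 r) => // er; rewrite er eqxx in nr.
    rewrite -mulmxA row_opMl //; apply/fiberwiseP => r.
    case: (s1 r) => // e1; case: (s2 r) => // e2.
    by move: neF; rewrite -e1 e2 eqxx.
  pose P h := (evec z *m rG h *m (A *m B) <= W)%MS.
  have := congr1 (mulmx (evec z)) van; rewrite mulmx0 mulmxA mulmx_sumr mulmx_suml.
  rewrite (bigID P) /=.
  rewrite [X in _ + X](eq_bigr (fun _ => evec z *m (A *m B))); last first.
    by move=> h /andP[/keep[]// hP]; rewrite /P hP.
  rewrite sumr_const => /eqP; rewrite addrC addr_eq0 => /eqP eqW.
  (* [k] counts the terms of the relation not yet known to lie in the span; the identity is among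
     them, so [k] can be divided out. *)
  set k := (X in _ *+ X) in eqW.
  have k0 : (k%:R : algC) != 0.
    rewrite pnatr_eq0 -lt0n; apply/card_gt0P; exists 1%g.
    by rewrite unfold_in perm_on1 /P repr_mx1 mulmx1; apply: zbad.
  case/negP: zbad.
  rewrite -(eqmx_scale _ k0) scaler_nat eqW.
  by rewrite eqmx_opp; apply: summx_sub => h /andP[].
have zss : semistandard z.
  have col_le (r r' : 'I_n) : col r = col r' -> (row r < row r')%N -> (F z r <= F z r')%N.
    move=> ec lt; rewrite leqNgt; apply/negP => ltF; apply: (col_strict r r') => //.
      exact: ltnW.
    by move=> el; rewrite el ltnn in ltF.
  apply/semistandardP; split=> [r r' er|r r' ec|r r' rr' el ec|]; last exact: row_odd.
  - rewrite leq_eqVlt => /orP[/eqP ec|]; last exact: row_sorted.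
    by rewrite (cell_inj er ec).
  - rewrite leq_eqVlt => /orP[/eqP er|]; last exact: col_le.
    by rewrite (cell_inj er ec).
  rewrite -[par _]negbK; apply/negP => npar.
  case: (ltngtP (row r) (row r')) => [lt|lt|er].
  - by apply: (col_strict r r') => //; rewrite el.
  - by apply: (col_strict r' r) => //; rewrite -el.
  by rewrite (cell_inj er ec) eqxx in rr'.
by case/negP: zbad; apply: (sumsmx_sup z) => //; rewrite genmxE.
Qed.

Lemma rank_le_semistandard : (\rank (A *m B) <= #|[set x | semistandard x]|)%N.
Proof.
have /mxrankS/leq_trans : (A *m B <= W)%MS.
  apply/row_subP => i; rewrite rowE -(enum_valK i); exact: straighten.
apply; apply: leq_trans (mxrank_sum_leqif _).1 _.
rewrite -[X in (_ <= X)%N]sum1_card (eq_bigl semistandard) => [|x]; last by rewrite inE.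
by apply: leq_sum => x _; rewrite /= genmxE rank_leq_row.
Qed.

End Straightening.

(** * Independence: a triangular order on fillings *)

Section Triangularity.

(** Compared lexicographically from the top row; invariant under row permutations. *)
Definition row_sums x : (size lam).-tuplelexi nat :=
  [tuple (\sum_(r < n | row r == i) F x r)%N | i < size lam].

Lemma row_lt_size (r : 'I_n) : (row r < size lam)%N.
Proof.
by rewrite ltnNge; apply: contraTN (col_lt lamP r) => le; rewrite nth_default.
Qed.

Lemma row_sums_act x p : p \in R -> row_sums (act x p) = row_sums x.
Proof.
move=> /fiberwiseP pR; apply: eq_from_tnth => i; rewrite !tnth_mktuple.
rewrite (reindex_inj (@perm_inj _ p)) /=.
by apply: eq_big => [r|r _]; rewrite ?pR ?lab_act.
Qed.

(** Both fillings have sorted rows with the same entries. Induction on the column compares them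
    through [sorted_first_diff], once with [p] and once with its inverse. *)
Lemma semistandard_row_inj x y p :
  semistandard x -> semistandard y -> p \in R -> act x p = y -> x = y.
Proof.
move=> /semistandardP[xrow _ _ _] /semistandardP[yrow _ _ _] pR xpy.
apply: lab_inj => r; apply: rk_inj.
have [N] := ubnP (col r); elim: N r => // N IH r; rewrite ltnS => leN.
have Ey z : F y (p z) = F x z by rewrite -xpy lab_act.
have Ex z : F x ((p^-1)%g z) = F y z by rewrite -Ey permKV.
have IH' z : (col z < col r)%N -> F x z = F y z.
  by move=> lt; apply: IH; apply: leq_trans lt leN.
apply/eqP; rewrite eqn_leq; apply/andP; split.
  rewrite -Ex; apply: (@sorted_first_diff _ _ (fun z => col z) (fun z => F x z) _ (col r)) => //.
  - exact: (groupVr pR).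
  - exact: xrow.
  - by move=> z lt /=; rewrite Ex IH'.
rewrite -Ey; apply: (@sorted_first_diff _ _ (fun z => col z) (fun z => F y z) _ (col r)) => //.
- exact: pR.
- exact: yrow.
by move=> z lt /=; rewrite Ey IH'.
Qed.

(** If [q] changes [y], consider the topmost row where it does: the columns of [y] are sorted, so
    entries of that row can only grow. The row sums of the result are those of [x], as [p] keeps
    them. *)
Lemma row_sums_decr x y p q :
    semistandard x -> semistandard y -> p \in R -> q \in C -> act x p = act y q ->
  x = y /\ act x p = x \/ (row_sums y < row_sums x)%O.
Proof.
move=> xs ys pR qC xpyq; have [eq_y|ne_y] := eqVneq (act y q) y.
  have xy := semistandard_row_inj xs ys pR (etrans xpyq eq_y).
  by left; split=> //; rewrite xpyq eq_y.
right; rewrite -(row_sums_act x pR) xpyq.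
have Eq z : F y ((q^-1)%g z) = F (act y q) z by rewrite -{2}(permKV q z) lab_act.
have [r ner rmin] : exists2 r : 'I_n, F (act y q) r != F y r &
    forall r' : 'I_n, (row r' < row r)%N -> F (act y q) r' = F y r'.
  have /existsP[r0 ner0] : [exists r, F (act y q) r != F y r].
    apply: contraR ne_y => /existsPn E; apply/eqP/lab_inj => r; apply: rk_inj.
    by apply/eqP; rewrite -[_ == _]negbK.
  case: (@arg_minnP _ r0 (fun r => F (act y q) r != F y r) (fun r => row r)) => // r ner rmin.
  exists r => // r' lt; apply/eqP; apply: contraTT lt => /rmin.
  by rewrite leqNgt.
have le r' : row r' = row r -> (F y r' <= F (act y q) r')%N.
  rewrite -Eq; have /semistandardP[_ ycol _ _] := ys.
  apply: (@sorted_first_diff _ _ (fun z => row z) (fun z => F y z)) => //.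
  - exact: (groupVr qC).
  - exact: ycol.
  - by move=> z lt /=; rewrite Eq rmin.
apply/ltxi_tuplePlt; exists (Ordinal (row_lt_size r)) => [i lt|].
  rewrite !tnth_mktuple; apply: eq_bigr => z /eqP ez; rewrite rmin // ez.
  exact: lt.
rewrite !tnth_mktuple /= ltEnat /= (bigD1 r) ?eqxx //= [X in (_ < X)%N](bigD1 r) ?eqxx //=.
rewrite -addSn; apply: leq_add; first by rewrite ltn_neqAle eq_sym ner le.
by apply: leq_sum => z /andP[/eqP ez _]; apply: le.
Qed.

Lemma young_entry x y :
  (evec x *m (A *m B)) 0 (enum_rank y) = \sum_(p in R) \sum_(q in C)
     (act x (p * q)%g == y)%:R * ((-1) ^+ odd_perm q * c (p * q)%g x).
Proof.
rewrite mulmx_suml mulmx_sumr summxE; apply: eq_bigr => p _.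
rewrite mulmx_sumr mulmx_sumr summxE; apply: eq_bigr => q _.
rewrite -scalemxAr -reprM -scalemxAr basis_act scalerA !mxE eqxx /= mulrC.
by congr (_%:R * _); rewrite (inj_eq enum_rank_inj) eq_sym.
Qed.

Lemma young_entry_lower x y : semistandard x -> semistandard y ->
  (evec x *m (A *m B)) 0 (enum_rank y) != 0 -> x = y \/ (row_sums y < row_sums x)%O.
Proof.
move=> xs ys; rewrite young_entry => nz.
have [/existsP[p /existsP[q /and3P[pR qC /eqP xpq]]]|H] := boolP [exists p, exists q,
    [&& p \in R, q \in C & act x (p * q)%g == y]].
  have [||[-> _]|lt] := @row_sums_decr x y p (q^-1)%g xs ys pR; [by rewrite groupV| |by left|by right].
  by rewrite -xpq actM -[RHS]actM mulgV act1.
case/eqP: nz; apply: big1 => p pR; apply: big1 => q qC; case: eqP => [e|]; last by rewrite mul0r.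
by case/existsP: H; exists p; apply/existsP; exists q; rewrite pR qC e eqxx.
Qed.

(** Whenever [p * q] fixes [x], so do [p] and [q] separately. Repeated labels are even in rows and
    odd in columns, so [p] has sign 1 and the sign of [q] cancels; the entry counts such pairs, and
    the identity pair is one. *)
Lemma young_entry_diag x : semistandard x ->
  (evec x *m (A *m B)) 0 (enum_rank x) != 0.
Proof.
move=> xs; have /semistandardP[_ _ xcol xrow] := xs.
have E p q : p \in R -> q \in C ->
    (act x (p * q)%g == x)%:R * ((-1) ^+ odd_perm q * c (p * q)%g x)
      = (act x (p * q)%g == x)%:R :> algC.
  move=> pR qC; case: eqP => [xpq|]; last by rewrite mul0r.
  have xp : act x p = x.
    have [||[_ ->]|] // := @row_sums_decr x x p (q^-1)%g xs xs pR.
    - by rewrite groupV.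
    - by rewrite -[in RHS]xpq actM -[RHS]actM mulgV act1.
    by rewrite ltxx.
  have xq : act x q = x by rewrite -{1}xp -actM.
  rewrite mul1r cM xp (stabilizer_sign _ (b := false) pR xp) ?mul1r => [|r r' rr' er el].
    rewrite (stabilizer_sign _ (b := true) qC xq) -?signr_addb ?addbb // => r r' rr' ec el.
    exact: xcol el ec.
  by apply/negbTE; apply: xrow el er.
rewrite young_entry (eq_bigr (fun p => \sum_(q in C) (act x (p * q)%g == x)%:R)); last first.
  by move=> p pR; apply: eq_bigr => q qC; apply: E.
rewrite (bigD1 1%g) ?group1 //= (bigD1 1%g) ?group1 //= mulg1 act1 eqxx.
rewrite -addrA lt0r_neq0 // ltr_pwDl ?ltr01 // addr_ge0 //.
  by apply: sumr_ge0 => q _; apply: ler0n.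
by apply: sumr_ge0 => p _; apply: sumr_ge0 => q _; apply: ler0n.
Qed.

(** In a linear dependency, take a filling with maximal row sums among those with nonzero
    coefficient: by triangularity no other term reaches its coordinate. *)
Lemma semistandard_le_rank : (#|[set x | semistandard x]| <= \rank (A *m B))%N.
Proof.
set S := [set x | semistandard x].
pose T := \matrix_(i < #|S|) (evec (enum_val i) *m (A *m B)).
have Sss (i : 'I_#|S|) : semistandard (enum_val i) by have := enum_valP i; rewrite inE.
have TE : T = (\matrix_(i < #|S|) evec (enum_val i)) *m (A *m B).
  by apply/row_matrixP => i; rewrite row_mul !rowK.
suff /eqP <- : row_free T by rewrite TE mxrankS // submxMl.
apply: inj_row_free => v vT; apply/rowP => i; rewrite [RHS]mxE; apply/eqP.
apply: contraT => vi.
have [j vj jmax] : exists2 j, v 0 j != 0 & forall k, v 0 k != 0 ->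
    (row_sums (enum_val k) <= row_sums (enum_val j))%O.
  exists [arg max_(j > i | v 0 j != 0) row_sums (enum_val j)]%O;
  by case: arg_maxP.
have : (v *m T) 0 (enum_rank (enum_val j)) != 0.
  rewrite mulmx_sum_row summxE (bigD1 j) //= big1 => [|k kj].
    by rewrite addr0 rowK mxE mulf_neq0 // young_entry_diag.
  rewrite rowK mxE; have [->|vk] := eqVneq (v 0 k) 0; first by rewrite mul0r.
  have [->|nz] := eqVneq ((evec (enum_val k) *m (A *m B)) 0 (enum_rank (enum_val j))) 0.
    by rewrite mulr0.
  have [/enum_val_inj e|] := young_entry_lower (Sss k) (Sss j) nz.
    by rewrite e eqxx in kj.
  by move/lt_geF; rewrite jmax.
by rewrite vT mxE eqxx.
Qed.

End Triangularity.

Lemma rank_semistandard : \rank (A *m B) = #|[set x | semistandard x]|.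
Proof.
by apply/eqP; rewrite eqn_leq rank_le_semistandard semistandard_le_rank.
Qed.

End SignedFillings.

(** * Monomials and multiset tableaux *)

(** Pairs avoiding [r] and [r'] are not flipped, pairs containing exactly one of them cancel in twos
    under the transposition, and the pair of both gives the sign. *)
Lemma setsgn_tperm n (r r' : 'I_n) (S : {set 'I_n}) :
    r != r' -> (r \in S) = (r' \in S) ->
  setsgn (tperm r r') S = if r \in S then -1 else 1.
Proof.
move=> rr' rS; set t := tperm r r'; rewrite /setsgn.
pose z P : algC := if flip t P then -1 else 1.
have z1 (P : {set 'I_n}) : r \notin P -> r' \notin P -> z P = 1.
  move=> rP r'P; rewrite /z; suff -> : flip t P = false by [].
  apply/existsP => -[x /andP[xP /existsP[y /and3P[yP xy]]]].
  have fixP u : u \in P -> t u = u.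
    by move=> uP; apply: tpermD; [apply: contraNneq rP | apply: contraNneq r'P] => ->.
  by rewrite !fixP // => /ltnW; rewrite leqNgt xy.
case: ifP => [rS'|/negbT nrS]; last first.
  apply: big1 => P /andP[/subsetP PS _]; apply: z1; first exact: contra (PS r) nrS.
  by rewrite rS in nrS; exact: contra (PS r') nrS.
have mem_t (P : {set 'I_n}) x : (x \in t @: P) = (t x \in P).
  by rewrite -{1}(tpermK r r' x) mem_imset //; apply: perm_inj.
have zt (P : {set 'I_n}) : #|P| == 2%N -> z (t @: P) = z P.
  move=> P2; have := flipM t t P2; rewrite tperm2 /z.
  have -> : flip 1 P = false.
    apply/existsP => -[x /andP[_ /existsP[y /and3P[_ xy]]]].
    by rewrite !perm1 => /ltnW; rewrite leqNgt xy.
  by case: (flip t P); case: (flip t _).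
have z2 (P : {set 'I_n}) : z P * z P = 1.
  by rewrite /z; case: ifP; rewrite ?mulrNN mulr1.
have cardt (P : {set 'I_n}) : #|t @: P| = #|P| by rewrite card_imset //; apply: perm_inj.
have tS (P : {set 'I_n}) : (t @: P \subset S) = (P \subset S).
  have tPS (Q : {set 'I_n}) : Q \subset S -> t @: Q \subset S.
    move=> /subsetP QS; apply/subsetP => x; rewrite mem_t => /QS.
    by rewrite /t; case: tpermP => // ->; rewrite ?rS // -rS.
  apply/idP/idP => [/tPS|]; last exact: tPS.
  by rewrite -imset_comp (eq_imset _ (tpermK r r')) imset_id.
rewrite (bigID (fun P : {set 'I_n} => r \in P)) /=.
rewrite (bigID (fun P : {set 'I_n} => r' \in P)) /=.
rewrite [X in _ * X](bigID (fun P : {set 'I_n} => r' \in P)) /=.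
rewrite [X in _ * (_ * X)]big1 ?mulr1 => [|P /andP[/andP[_ ?] ?]]; last exact: z1.
rewrite (big_pred1 [set r; r']) => [|P]; last first.
  apply/idP/eqP => [/andP[/andP[/andP[_ /eqP P2] rP] r'P]|->].
    apply/esym/eqP; rewrite eqEcard P2 cards2 rr' andbT.
    by apply/subsetP => x; rewrite !inE => /orP[]/eqP->.
  rewrite !inE !eqxx orbT cards2 rr' !andbT.
  by apply/subsetP => x; rewrite !inE => /orP[]/eqP->; rewrite -?rS.
(* Reindexing by [t] turns the pairs with [r] but not [r'] into those with [r'] but not [r], so that
   equal signs multiply to 1. *)
rewrite (reindex_inj (imset_inj (@perm_inj _ t))) /=.
rewrite -mulrA; set a := \prod_(i | _) _; set b := \prod_(i | _) _.
suff -> : a * b = 1.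
  rewrite mulr1 flip2 // tpermL tpermR.
  have : (r : nat) != r' by [].
  by case: (ltngtP r r').
pose I (P : {set 'I_n}) := [&& P \subset S, #|P| == 2%N, r \notin P & r' \in P].
have -> : a = \prod_(P : {set 'I_n} | I P) z (t @: P).
  apply: eq_bigl => P; rewrite tS cardt !mem_t tpermL tpermR /I.
  by rewrite -!andbA; congr [&& _, _ & _]; rewrite andbC.
have -> : b = \prod_(P : {set 'I_n} | I P) z P.
  by apply: eq_bigl => P; rewrite /I -!andbA.
rewrite -big_split /=; apply: big1 => P /and4P[_ P2 _ _].
by rewrite zt.
Qed.

Lemma lexleE (s t : seq nat) : lexle s t = (s <= t :> seqlexi nat)%O.
Proof.
elim: s t => [|x s IH] [|y t] //=; rewrite lexi_cons IH !leEnat.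
by case: ltngtP => //= ->.
Qed.

Section Tableaux.
Variables (n m mp : nat) (alpha : 'I_m -> nat) (beta : 'I_mp -> nat).

Notation label := (mset alpha beta).
Implicit Types M N : label.

Lemma count_mset_word M v :
  count_mem v (mset_word M) =
    (\sum_(k < m) (k == v :> nat) * M (inl k) + \sum_(i < mp) (m + i == v)%N * M (inr i))%N.
Proof.
rewrite /mset_word flatten_cat count_cat !count_flatten -!map_comp !sumnE !big_map -!enumT !big_enum /=.
by congr (_ + _)%N; apply: eq_bigr => k _; rewrite count_nseq.
Qed.

Lemma count_mset_word_inl M (k : 'I_m) : count_mem (k : nat) (mset_word M) = M (inl k).
Proof.
rewrite count_mset_word (bigD1 k) //= eqxx mul1n -[RHS]addn0 -addnA; congr (_ + _)%N.
apply/eqP; rewrite addn_eq0; apply/andP; split; apply/eqP; apply: big1; [move=> j jk | move=> i _].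
  by rewrite (negbTE (jk : (j : nat) != k)).
by rewrite gtn_eqF // (leq_trans (ltn_ord k)) // leq_addr.
Qed.

Lemma count_mset_word_inr M (i : 'I_mp) : count_mem (m + i)%N (mset_word M) = M (inr i).
Proof.
rewrite count_mset_word addnC (bigD1 i) //= eqxx mul1n -[RHS]addn0 -addnA; congr (_ + _)%N.
apply/eqP; rewrite addn_eq0; apply/andP; split; apply/eqP; apply: big1; [move=> j ji | move=> k _].
  by rewrite eqn_add2l (negbTE (ji : (j : nat) != i)).
by rewrite ltn_eqF // (leq_trans (ltn_ord k)) // leq_addr.
Qed.

Lemma mset_word_inj : injective (@mset_word m mp alpha beta).
Proof.
move=> M N eMN; apply/ffunP => -[k|i]; apply: val_inj.
  by rewrite /= -!count_mset_word_inl eMN.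
by rewrite /= -!count_mset_word_inr eMN.
Qed.

(** The number of smaller labels turns the order on multisets into the numeric ranks of the
    straightening argument. *)
Definition mset_rank M : nat :=
  #|[set N : label | (mset_word N < mset_word M :> seqlexi nat)%O]|.

Lemma mset_rank_le M N : (mset_rank M <= mset_rank N)%N = msle M N.
Proof.
rewrite /msle lexleE; apply/idP/idP => [|le]; last first.
  by apply/subset_leq_card/subsetP => P; rewrite !inE => /lt_le_trans; apply.
rewrite leNgt; apply: contraL => lt; rewrite -ltnNge; apply: proper_card.
apply/properP; split; last by exists N; rewrite !inE ?ltxx.
by apply/subsetP => P; rewrite !inE => /lt_trans; apply.
Qed.

Lemma mset_rank_inj : injective mset_rank.
Proof.
move=> M N e; apply: mset_word_inj; apply: (@le_anti _ (seqlexi nat)).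
by rewrite -!lexleE -![lexle _ _]/(msle _ _) -!mset_rank_le e leqnn.
Qed.

(** The variables of the monomial with first index [r], read as a multiset; this makes a monomial a
    filling of the numbered cells. *)
Definition row_label (x : deg_monomial n alpha beta) (r : 'I_n) : label :=
  [ffun l => inord match l with
             | inl k => (val x).1 k r
             | inr i => (r \in (val x).2 i)
             end].

Lemma row_label_inl x r k : row_label x r (inl k) = (val x).1 k r :> nat.
Proof.
rewrite ffunE inordK // ltnS; apply: leq_trans (leq_addr _ _).
by rewrite -ltnS.
Qed.

Lemma row_label_inr x r i : row_label x r (inr i) = (r \in (val x).2 i) :> nat.
Proof.
rewrite ffunE inordK // ltnS; case rS: (r \in _) => //.
have /andP[_ /forallP/(_ i)/eqP bi] := valP x.
rewrite (bigD1 i) //= -bi addnCA; apply: ltn_addr.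
by apply/card_gt0P; exists r.
Qed.

Lemma row_label_act x g r : row_label (dmon_act x g) (g r) = row_label x r.
Proof.
apply/ffunP => -[k|i]; rewrite !ffunE /= ?ffunE ?permK //.
by rewrite mem_imset //; apply: perm_inj.
Qed.

Lemma row_label_inj x y : row_label x =1 row_label y -> x = y.
Proof.
move=> exy; apply: val_inj.
have e1 : (val x).1 = (val y).1.
  apply/ffunP => k; apply/ffunP => r; apply: val_inj.
  by rewrite /= -!row_label_inl exy.
have e2 : (val x).2 = (val y).2.
  apply/ffunP => i; apply/setP => r.
  by have := row_label_inr x r i; rewrite exy row_label_inr; do 2!case: (r \in _).
by move: e1 e2; case: (val x) (val y) => [a b] [a' b'] /= -> ->.
Qed.

(** A Grassmannian column contains both rows or neither, and contributes a factor -1 exactly in the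
    first case. *)
Lemma mon_sign_tperm x r r' : r != r' -> row_label x r = row_label x r' ->
  mon_sign (tperm r r') x = (-1) ^+ odd (nbarred (row_label x r)).
Proof.
move=> rr' el; rewrite signr_odd /nbarred -prodrXr; apply: eq_bigr => i _.
have := row_label_inr x r i; rewrite el row_label_inr => rS.
rewrite setsgn_tperm //; last by move: rS; do 2!case: (_ \in _).
by case: (r' \in _) rS; case: (r \in _).
Qed.

Variable lam : seq nat.
Hypothesis lamP : is_partition n lam.

Notation row r := (rowof lam (nat_of_ord r)).
Notation col r := (colof lam (nat_of_ord r)).
Notation rk := mset_rank.
Notation par := (fun M : label => odd (nbarred M)).
Notation tableau := {ffun cell n lam -> label}.
Implicit Types (x : deg_monomial n alpha beta) (T : tableau).

Lemma cell_bij : exists2 f : cell n lam -> 'I_n,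
  bijective f & forall d, row (f d) = crow d /\ col (f d) = ccol d.
Proof.
have H (d : cell n lam) : exists r : 'I_n, row r = crow d /\ col r = ccol d.
  by case/andP: (valP d) => _; apply: cell_at.
have [f fP] := fin_all_exists H; exists f => //.
have finj : injective f.
  move=> d d' e; have [e1 e2] := fP d; have [e1' e2'] := fP d'.
  apply: val_inj; rewrite [LHS]surjective_pairing [RHS]surjective_pairing.
  by congr (_, _); apply: val_inj; rewrite /= -/(crow _) -/(ccol _) -?e1 -?e2 e ?e1' ?e2'.
have surj (r : 'I_n) : exists d, f d == r.
  (* No part is zero, so there are at most [n] rows and the cell fits into the square that bounds
     [cell]. *)
  have ltr : (row r < n)%N.
    have /and3P[/eqP ls _ l0] := lamP; apply: leq_trans (row_lt_size lamP r) _.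
    rewrite -[X in (_ <= X)%N]ls; elim: (lam) l0 => //= -[|a] l IH.
      by rewrite inE eqxx.
    by rewrite inE => /IH le; rewrite addSn ltnS (leq_trans le) ?leq_addl.
  have ltc : (col r < n)%N.
    have := ltn_ord r; rewrite /colof; exact/leq_ltn_trans/leq_subr.
  have dP : @in_shape n lam (Ordinal ltr, Ordinal ltc).
    by rewrite /in_shape /= (row_lt_size lamP) (col_lt lamP).
  exists (Sub _ dP : cell n lam); apply/eqP.
  by have [e1 e2] := fP (Sub _ dP : cell n lam); apply: cell_inj e1 e2.
have surj2 r := xchooseP (surj r).
exists (fun r => xchoose (surj r)) => [d|r]; last exact/eqP.
by apply: finj; apply/eqP.
Qed.

(** Monotonicity between neighbours spreads along a line by induction on the distance, since the
    shape contains every cell in between. *)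
Lemma semistandard_tableau x (f : cell n lam -> 'I_n) T :
    bijective f -> (forall d, row (f d) = crow d /\ col (f d) = ccol d) ->
    (forall d, T d = row_label x (f d)) ->
  semistandard lam row_label rk par x = is_multiset_tableau T.
Proof.
move=> [g fK gK] fP TE; have Tg r : row_label x r = T (g r) by rewrite TE gK.
have gP r : crow (g r) = row r /\ ccol (g r) = col r.
  by have [<- <-] := fP (g r); rewrite gK.
apply/semistandardP/and5P => [[H1 H2 H3 H4]|[H0 H1 H2 H3 H4]].
  split; apply/forallP => d; apply/forallP => d'.
  - by rewrite TE row_label_inr; case: (_ \in _).
  - have [er ec] := fP d; have [er' ec'] := fP d'.
    rewrite -er -er' -ec -ec'; apply/implyP => /andP[/eqP e1 /eqP e2].
    by rewrite !TE -mset_rank_le H2 // e1.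
  - have [er ec] := fP d; have [er' ec'] := fP d'.
    rewrite -er -er' -ec -ec'; apply/implyP => /andP[/eqP e1 /eqP e2].
    by rewrite !TE -mset_rank_le H1 // e2.
  - have [_ <-] := fP d; have [_ <-] := fP d'.
    rewrite !TE; apply/implyP => /and3P[dd' /eqP el]; apply: contraNneq => ec.
    by apply: (H3 _ (f d')) => //; rewrite (inj_eq (can_inj fK)).
  have [<- _] := fP d; have [<- _] := fP d'.
  rewrite !TE; apply/implyP => /and3P[dd' /eqP el]; apply: contraTneq => er.
  by apply: (H4 _ (f d')) => //; rewrite (inj_eq (can_inj fK)).
split=> [r r' er lec|r r' ec ler|r r' rr' el ec|r r' rr' el er].
- have [k] : exists k, (col r' = col r + k)%N by exists (col r' - col r)%N; rewrite subnKC.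
  elim: k r' er {lec} => [|k IH] r' er ek; first by rewrite (cell_inj er) // ek addn0.
  have [s [es1 es2]] : exists s : 'I_n, row s = row r' /\ col s = (col r + k)%N.
    by apply: (cell_at lamP); apply: leq_trans (col_lt lamP r'); rewrite ek addnS.
  apply: leq_trans (IH s _ es2) _; first by rewrite es1.
  have [a b] := gP s; have [a' b'] := gP r'.
  rewrite mset_rank_le !Tg; apply: (implyP (forallP (forallP H2 (g s)) (g r'))).
  by rewrite a b a' b' es1 es2 ek addnS !eqxx.
- have [k] : exists k, (row r' = row r + k)%N by exists (row r' - row r)%N; rewrite subnKC.
  elim: k r' ec {ler} => [|k IH] r' ec ek.
    by rewrite (@cell_inj n lam r r') // ek addn0.
  have [|s [es1 es2]] := @cell_above n lam lamP r' (row r + k)%N; first by rewrite ek addnS.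
  apply: leq_trans (IH s _ es1) _; first by rewrite es2.
  have [a b] := gP s; have [a' b'] := gP r'.
  rewrite mset_rank_le !Tg; apply: (implyP (forallP (forallP H1 (g s)) (g r'))).
  by rewrite a b a' b' es1 es2 ek addnS !eqxx.
- rewrite -[odd _]negbK; apply/negP => npar.
  have := implyP (forallP (forallP H3 (g r)) (g r')).
  rewrite (gP r).2 (gP r').2 ec -!Tg el eqxx -el npar (inj_eq (can_inj gK)) rr' eqxx.
  by move/(_ isT).
apply/negP => opar; have := implyP (forallP (forallP H4 (g r)) (g r')).
rewrite (gP r).1 (gP r').1 er -!Tg el eqxx -el opar (inj_eq (can_inj gK)) rr' eqxx.
by move/(_ isT).
Qed.

Lemma card_semistandard :
  #|[set x | semistandard lam row_label rk par x]| = #|multiset_tableaux n alpha beta lam|.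
Proof.
have [f fbij fP] := cell_bij; have [g fK gK] := fbij.
pose tab x : tableau := [ffun d => row_label x (f d)].
have tabE x d : tab x d = row_label x (f d) by rewrite ffunE.
have tab_inj : injective tab.
  move=> x y e; apply: row_label_inj => r.
  by rewrite -[r]gK -!tabE e.
rewrite -(card_imset _ tab_inj); apply: eq_card => T; rewrite inE.
have sum_cells (h : 'I_n -> nat) : (\sum_(d : cell n lam) h (f d) = \sum_r h r)%N.
  by rewrite [RHS](reindex f) //; apply: onW_bij.
have card_sum (Q : {set 'I_n}) : #|Q| = (\sum_(d : cell n lam) (f d \in Q))%N.
  rewrite (sum_cells (fun r => (r \in Q) : nat)) -sum1_card big_mkcond.
  by apply: eq_bigr => r _; case: (r \in Q).
apply/imsetP/andP => [[x]|[Ttab /andP[/forallP Ta /forallP Tb]]].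
  rewrite inE (semistandard_tableau fbij fP (tabE x)) => xtab ->; split=> //.
  have /andP[/forallP xa /forallP xb] := valP x.
  apply/andP; split; apply/forallP => k.
    rewrite -(eqP (xa k)) -(sum_cells (fun r => (val x).1 k r : nat)).
    by apply/eqP/eq_bigr => d _; rewrite tabE row_label_inl.
  rewrite -(eqP (xb k)) card_sum.
  by apply/eqP/eq_bigr => d _; rewrite tabE row_label_inr.
have /and5P[/forallP T1 _ _ _ _] := Ttab.
(* The inverse of [tab]. The content bounds the exponents, and sets suffice for the Grassmannian
   part because no barred letter repeats within a label. *)
pose y : monomial n mp alpha :=
  ([ffun k => [ffun r => inord (T (g r) (inl k))]],
   [ffun i => [set r | T (g r) (inr i) == 1%N :> nat]]).
have yE1 k r : y.1 k r = T (g r) (inl k) :> nat.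
  rewrite !ffunE inordK // ltnS; apply: (@leq_trans (alpha k)).
    by rewrite -(eqP (Ta k)) (bigD1 (g r)) //= leq_addr.
  by rewrite (bigD1 k) //= leq_addr.
have yE2 i r : (r \in y.2 i) = T (g r) (inr i) :> nat.
  by rewrite ffunE inE; have := forallP (T1 (g r)) i; case: (nat_of_ord _) => [|[]].
have ydeg : has_degree beta y.
  apply/andP; split; apply/forallP => k.
    rewrite -(eqP (Ta k)) -(sum_cells (fun r => y.1 k r : nat)).
    by apply/eqP/eq_bigr => d _; rewrite yE1 fK.
  rewrite -(eqP (Tb k)) card_sum.
  by apply/eqP/eq_bigr => d _; rewrite yE2 fK.
pose x : deg_monomial n alpha beta := Sub y ydeg.
have Tx d : T d = row_label x (f d).
  apply/ffunP => -[k|i]; apply: val_inj.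
    by rewrite /= row_label_inl /= yE1 fK.
  by rewrite /= row_label_inr /= yE2 fK.
exists x; first by rewrite inE (semistandard_tableau fbij fP Tx).
by apply/ffunP => d; rewrite tabE Tx.
Qed.

End Tableaux.

(* The multiplicity of the irreducible S_n-module indexed by lam (the Specht
   module) in the degree-(alpha, beta) component, i.e. the character inner
   product '[chi_component, chi_lam], equals the number of multiset tableaux
   of shape lam and content {{1^alpha_1, .., m^alpha_m, 1bar^beta_1, ..}}. *)
Theorem theorem3p1 (n m mp : nat) (alpha : 'I_m -> nat) (beta : 'I_mp -> nat)
    (lam : seq nat) :
  (1 <= n)%N -> is_partition n lam ->
  '[cfRepr (component_repr n alpha beta), cfRepr (specht_repr n lam)]
    = (#|multiset_tableaux n alpha beta lam|)%:R.
Proof.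
move=> _ lamP; rewrite (cfdot_specht lamP) -(card_semistandard alpha beta lamP).
congr _%:R; apply: (rank_semistandard lamP (act := @dmon_act n m mp alpha beta)
  (c := @mon_sign n m mp alpha beta)).
- exact: dmon_act1.
- exact: dmon_actM.
- exact: mon_sign1.
- exact: mon_signM.
- exact: mset_rank_inj.
- exact: row_label_act.
- exact: row_label_inj.
- exact: mon_sign_tperm.
by [].
Qed.
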